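(* Let $m$ be the measure driven by a Markov chain on $\mathcal{S}=\{0,\dots,\ell-1\}$ with initial distribution $(p_i)_{i\in\mathcal{S}}$ and irreducible transition matrix $P=(p_{ij})$, let $\tau$ be its structure function, and let $K=\operatorname{supp} m$ be its (closed) support. Let $P_0$ be the $0$–$1$ matrix with entry $1$ at $(i,j)$ if and only if $p_{ij}>0$, let $\lambda_0$ be its spectral radius, let $\pi_0$ be the unique probability (column) vector with $P_0\pi_0=\lambda_0\pi_0$ (its entries are strictly positive), let $D_0$ be the diagonal matrix with the coordinates of $\pi_0$ on the diagonal, and let $Q_0=\frac{1}{\lambda_0}D_0^{-1}P_0D_0$, which is a stochastic matrix. Let $\overline{m}$ be the measure driven by the Markov chain with transition matrix $Q_0$ and with initial distribution the uniform distribution on $\{i\in\mathcal{S}:p_i>0\}$. Then $\operatorname{supp}\overline{m}=K$, $\overline{m}$ is monofractal, and $\overline{m}$ is strongly equivalent to the restriction to $K$ of the Hausdorff measure $\mathcal{H}^{\tau(0)}$. In particular, $$\dim(\overline{m})=\dim_H(K)=\dim_B(K),$$ and $\overline{m}$ is a measure driven by a Markov chain, with support $K$, and with maximal dimension: $\dim^* m'\le\dim\overline{m}$ for every measure $m'$ driven by a Markov chain on $\mathcal{S}$ with $\operatorname{supp}m'=K$.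
   Context: Let $\ell\ge 2$ be an integer and $\mathcal{S}=\{0,1,\dots,\ell-1\}$. For $n\ge1$ and a word $\varepsilon_1\cdots\varepsilon_n\in\mathcal{S}^n$ let $I_{\varepsilon_1\cdots\varepsilon_n}=\big[\sum_{i=1}^n\varepsilon_i\ell^{-i},\ \sum_{i=1}^n\varepsilon_i\ell^{-i}+\ell^{-n}\big)$; $\mathcal{F}_n$ is the set of these intervals, $I_n(x)$ is the unique element of $\mathcal{F}_n$ containing $x\in[0,1)$, and $|I|$ is the length of $I$. Given a probability vector $(p_i)_{i\in\mathcal{S}}$ (initial distribution) and a stochastic matrix $P=(p_{ij})_{i,j\in\mathcal{S}}$ (transition matrix), always assumed to satisfy $p_{ij}\neq 1$ for all $i,j$, the measure driven by the corresponding Markov chain is the unique Borel probability measure $m$ carried by $[0,1)$ with $m(I_{\varepsilon_1\cdots\varepsilon_n})=p_{\varepsilon_1}p_{\varepsilon_1\varepsilon_2}\cdots p_{\varepsilon_{n-1}\varepsilon_n}$ for all words. $P$ is irreducible if for all $i,j$ there is $n\ge1$ with $(P^n)_{ij}>0$. The structure function is $\tau(q)=\limsup_{n\to\infty}\frac{1}{n\log\ell}\log\big(\sum_{I\in\mathcal{F}_n}m(I)^q\big)$ with the convention $0^q=0$ for all $q\in\mathbb{R}$; so $\tau(0)$ is the exponential growth rate, in base $\ell$, of the number of $I\in\mathcal{F}_n$ with $m(I)>0$. Two Borel measures $\mu,\nu$ are strongly equivalent if there is $c>0$ with $c^{-1}\nu(A)\le\mu(A)\le c\,\nu(A)$ for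 all Borel $A$. For real $\alpha$ and a measure $\mu$ on $[0,1)$ let $E_\alpha(\mu)=\{x\in[0,1):\lim_{n\to\infty}\log\mu(I_n(x))/\log|I_n(x)|=\alpha\}$; $\mu$ is multifractal if $E_\alpha(\mu)\ne\emptyset$ for at least two real values of $\alpha$, and monofractal if $E_\alpha(\mu)\neq\emptyset$ for exactly one real $\alpha$. For a Borel probability measure $\mu$: $\dim_*\mu=\inf\{\dim_H E: E\text{ Borel},\mu(E)>0\}$, $\dim^*\mu=\inf\{\dim_H E:E\text{ Borel},\mu(E)=1\}$, and $\dim\mu$ is the common value when they coincide. $\dim_H$, $\dim_B$ are Hausdorff and box dimension. *)

(* Defs.v *)
Set Warnings "-notation-overridden,-notation-incompatible-prefix".
From mathcomp Require Import all_boot all_order all_algebra.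
From mathcomp Require Import all_classical all_reals all_analysis.
From mathcomp Require Import complex.
Import Order.TTheory GRing.Theory Num.Theory.
Import numFieldNormedType.Exports.

Set Implicit Arguments.
Unset Strict Implicit.
Unset Printing Implicit Defensive.

Local Open Scope classical_set_scope.
Local Open Scope ring_scope.

(** * Vectors and matrices *)

Definition prob_vector (R : realType) (l : nat) (p : 'cV[R]_l) : Prop :=
  (forall i, 0 <= p i 0) /\ \sum_i p i 0 = 1.

Definition stochastic (R : realType) (l : nat) (P : 'M[R]_l) : Prop :=
  (forall i j, 0 <= P i j) /\ (forall i, \sum_j P i j = 1).

Definition irreducible_mx (R : realType) (l : nat) (P : 'M[R]_l) : Prop :=
  forall i j, exists2 n : nat, (1 <= n)%N & 0 < (P ^+ n) i j.

Definition spectral_radius (R : realType) (l : nat) (A : 'M[R]_l) : R :=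
  sup [set Normc.normc z | z in
        [set z : R[i] | eigenvalue (map_mx (real_complex R) A) z]].

Definition zero_one_mx (R : realType) (l : nat) (P : 'M[R]_l) : 'M[R]_l :=
  \matrix_(i, j) (0 < P i j)%R%:R.

Definition perron_vector (R : realType) (l : nat) (A : 'M[R]_l)
    (v : 'cV[R]_l) : Prop :=
  prob_vector v /\ A *m v = spectral_radius A *: v.

Definition perron_stochastic_mx (R : realType) (l : nat) (A : 'M[R]_l) (v : 'cV[R]_l) :
    'M[R]_l :=
  let D := diag_mx v^T in
  (spectral_radius A)^-1 *: (invmx D *m A *m D).

Definition unif_support (R : realType) (l : nat) (p : 'cV[R]_l) : 'cV[R]_l :=
  \col_i (if 0 < p i 0 then (#|[set j | 0 < p j 0]%SET|%:R)^-1 else 0).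

(** * l-adic intervals *)

Definition word_point (R : realType) (l n : nat) (w : n.-tuple 'I_l) : R :=
  \sum_(k < n) (tnth w k)%:R / l%:R ^+ k.+1.

Definition adic_itv (R : realType) (l n : nat) (w : n.-tuple 'I_l) : set R :=
  `[word_point R w, word_point R w + l%:R ^- n[.
Arguments adic_itv R {l n} w.

(* for [x] outside [[0, 1[] no such interval exists and the value is [set0] *)
Definition adic_itv_at (R : realType) (l n : nat) (x : R) : set R :=
  xget set0 [set I | (exists w : n.-tuple 'I_l, I = adic_itv R w) /\ I x].

(** * Measures driven by Markov chains *)

(* the side condition [P i j != 1] is part of the notion: it is what makes the
   cylinder weights below countably additive on half-open intervals *)
Definition markov_chain (R : realType) (l : nat) (p : 'cV[R]_l)
    (P : 'M[R]_l) : Prop :=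
  [/\ prob_vector p, stochastic P & forall i j, P i j != 1].

Fixpoint path_weight (R : realType) (l : nat) (P : 'M[R]_l) (i : 'I_l)
    (s : seq 'I_l) : R :=
  if s is j :: s' then P i j * path_weight P j s' else 1.

Definition word_weight (R : realType) (l : nat) (p : 'cV[R]_l) (P : 'M[R]_l)
    (w : seq 'I_l) : R :=
  if w is i :: s then p i 0 * path_weight P i s else 1.

Definition driven_by (R : realType) (l : nat) (p : 'cV[R]_l) (P : 'M[R]_l)
    (m : probability (measurableTypeR R) R) : Prop :=
  m `[0%R, 1%R[%classic = 1%E /\
  forall (n : nat) (w : n.-tuple 'I_l), (1 <= n)%N ->
    m (adic_itv R w) = (word_weight p P w)%:E.

Definition markov_driven (R : realType) (l : nat)
    (m : probability (measurableTypeR R) R) : Prop :=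
  exists (p : 'cV[R]_l) (P : 'M[R]_l), markov_chain p P /\ driven_by p P m.

(** * Support, equivalence, multifractal notions *)

Definition msupp (R : realType) (mu : set R -> \bar R) : set R :=
  [set x | forall U : set R, open U -> U x -> (0 < mu U)%E].

Definition strongly_equivalent (R : realType) (mu nu : set R -> \bar R) :
    Prop :=
  exists2 c : R, 0 < c & forall A : set (measurableTypeR R), measurable A ->
    (c^-1%:E * nu A <= mu A)%E /\ (mu A <= c%:E * nu A)%E.

(* [0 ^ q = 0] for every real [q], including [q <= 0] *)
Definition pow_conv (R : realType) (x : \bar R) (q : R) : \bar R :=
  if x == 0%E then 0%E else (x `^ q)%E.

(* distinct words give distinct intervals, so the sum over words is the sum
   over the intervals of generation [n] *)
Definition structure_fun (R : realType) (l : nat) (mu : set R -> \bar R)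
    (q : R) : \bar R :=
  limn_esup (fun n => lne (\sum_(w : n.-tuple 'I_l)
                             pow_conv (mu (adic_itv R w)) q)
                      / (n%:R * ln l%:R)%:E)%E.

(* [lne 0 = -oo], hence the ratio is [+oo] when the interval is [mu]-null *)
Definition level_set (R : realType) (l : nat) (mu : set R -> \bar R)
    (alpha : R) : set R :=
  [set x | 0 <= x < 1 /\
    (fun n => (lne (mu (adic_itv_at l n x)) /
               lne (@lebesgue_measure R (adic_itv_at l n x)))%E)
      @ \oo --> alpha%:E].

Definition monofractal (R : realType) (l : nat) (mu : set R -> \bar R) :
    Prop :=
  exists! alpha : R, level_set l mu alpha !=set0.

(** * Hausdorff measures and dimensions on the real line *)

Definition diam (R : realType) (U : set R) : \bar R :=
  ereal_sup [set `|z.1 - z.2|%:E | z in U `*` U].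

(* the empty set contributes [0] also when [s = 0], while a singleton then
   contributes [0 `^ 0 = 1] *)
Definition gauge (R : realType) (s : R) (U : set R) : \bar R :=
  if pselect (U = set0) then 0%E else (diam U `^ s)%E.

Definition hausdorff_premeasure (R : realType) (s delta : R) (A : set R) :
    \bar R :=
  ereal_inf [set (\sum_(i <oo) gauge s (U i))%E | U in
    [set U : nat -> set R | (forall i, diam (U i) <= delta%:E)%E /\
                            A `<=` \bigcup_i U i]].

Definition hausdorff_measure (R : realType) (s : R) (A : set R) : \bar R :=
  ereal_sup [set hausdorff_premeasure s delta A | delta in [set d | 0 < d]].

Definition hausdorff_dim (R : realType) (A : set R) : \bar R :=
  ereal_inf [set s%:E | s in [set s | 0 <= s /\ hausdorff_measure s A = 0%E]].

Definition covering_number (R : realType) (A : set R) (delta : R) : \bar R :=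
  ereal_inf [set n%:R%:E | n in
    [set n | exists U : 'I_n -> set R,
               (forall i, diam (U i) <= delta%:E)%E /\
               A `<=` \bigcup_i U i]].

Definition has_box_dim (R : realType) (A : set R) (d : \bar R) : Prop :=
  (fun delta : R => (lne (covering_number A delta) / (- ln delta)%:E)%E)
    @ 0^'+ --> d.

Definition lower_dim (R : realType) (mu : set R -> \bar R) : \bar R :=
  ereal_inf [set hausdorff_dim E | E in
    [set E : set (measurableTypeR R) | measurable E /\ (0 < mu E)%E]].

Definition upper_dim (R : realType) (mu : set R -> \bar R) : \bar R :=
  ereal_inf [set hausdorff_dim E | E in
    [set E : set (measurableTypeR R) | measurable E /\ mu E = 1%E]].

Definition has_dim (R : realType) (mu : set R -> \bar R) (d : \bar R) : Prop :=
  lower_dim mu = d /\ upper_dim mu = d.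

(* Main.v *)
Require Import Defs.
From HB Require Import structures.
From mathcomp Require Import all_boot all_order all_algebra.
From mathcomp Require Import all_classical all_reals all_analysis.
From mathcomp Require Import measurable_realfun complex ring lra.
Import Order.TTheory GRing.Theory Num.Theory.
Import numFieldNormedType.Exports.

Local Open Scope classical_set_scope.
Local Open Scope ring_scope.

(** The geometric part is proved for every measure satisfying [adic_regular], which does not mention
    the chain. The matrix [P] and the vector [p] matter only through the positions of their positive
    entries: [Q0] and [unif_support p] have the same ones, so [m] and [mbar] charge the same adic
    intervals. This yields equal supports and lets [tau 0] of [m] be computed from [mbar]. The
    initial distribution and the boundary factors left by telescoping cost only a constant.

    The obstacle is that adic intervals are half-open while [K] is closed: a point of [K], possibly
    1, may be just the right end of a non-null interval. So [K] is described and covered by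
    closures, and the change of endpoints is harmless because [lam > 1] excludes atoms. The same
    decay gives the existence of [mbar]: weights that tend to 0 uniformly have a continuous
    distribution function, whose Stieltjes measure gives half-open intervals exactly their
    weights. *)

(** No entry of [P] is 1, so every row has two positive entries and the
    Perron-Frobenius eigenvalue [lam] of [P0] exceeds 1. Along an admissible word
    the entries of [Q0] telescope, so that [mbar I] is either 0 or comparable to
    [lam ^- n = |I| ^ s] for [I] of generation [n], where [s = ln lam / ln l].
    The mass distribution principle then bounds [mbar] by the [s]-dimensional
    Hausdorff measure on [K]; conversely, covering [K] inside an interval [J] by the
    closures of the non-null adic intervals meeting [J] bounds the Hausdorff measure
    of [J `&` K] by [mbar J], and outer regularity passes from intervals to Borel
    sets. There are about [lam ^+ n] non-null intervals of generation [n], which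
    gives [tau 0] and the box dimension. Finally [m' K = 1] for every [m'] with
    support [K], hence the upper dimension of [m'] is at most that of [K]. *)

(** * Perron-Frobenius theory *)

Section perron_frobenius.
Context {R : realType} {l : nat}.
Implicit Types (A B : 'M[R]_l) (v w x : 'cV[R]_l) (lam : R).

Lemma mulmx_ge0 m n q (A : 'M[R]_(m, n)) (B : 'M[R]_(n, q)) :
  (forall i j, 0 <= A i j) -> (forall i j, 0 <= B i j) ->
  forall i j, 0 <= (A *m B) i j.
Proof.
by move=> A0 B0 i j; rewrite mxE; apply: sumr_ge0 => k _; rewrite mulr_ge0.
Qed.

Lemma expmx_le A B : (forall i j, 0 <= A i j) ->
  (forall i j, A i j <= B i j) ->
  forall n i j, 0 <= (A ^+ n) i j <= (B ^+ n) i j.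
Proof.
move=> A0 AB; elim => [|n IH] i j; first
  by rewrite !expr0 lexx andbT -[1]/(1%:M) mxE ler0n.
rewrite !exprS; apply/andP; split.
  by apply: mulmx_ge0 => // a b; have /andP[] := IH a b.
rewrite !mxE; apply: ler_sum => k _; have /andP[? ?] := IH k j.
by rewrite ler_pM.
Qed.

Lemma expmx_ge0 A : (forall i j, 0 <= A i j) ->
  forall n i j, 0 <= (A ^+ n) i j.
Proof. by move=> A0 n i j; have /andP[] := expmx_le A A A0 (fun _ _ => lexx _) n i j. Qed.

Lemma expmx_eigenvector A v lam n :
  A *m v = lam *: v -> A ^+ n *m v = lam ^+ n *: v.
Proof.
move=> Av; elim: n => [|n IH]; first by rewrite !expr0 mul1mx scale1r.
by rewrite exprS -[_ * _]/(A *m (A ^+ n)) -mulmxA IH -scalemxAr Av scalerA -exprSr.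
Qed.

(** If [v j 0 = 0], coordinate [j] of [A ^+ n *m v] is a vanishing sum of nonnegative terms;
    irreducibility supplies an [n] for which the term of a nonzero [v i 0] is positive. *)
Lemma irreducible_eigenvector_gt0 A v lam :
  (forall i j, 0 <= A i j) -> irreducible_mx A ->
  (forall i, 0 <= v i 0) -> v != 0 -> A *m v = lam *: v ->
  forall i, 0 < v i 0.
Proof.
move=> A0 irrA v0 vn0 Av j.
have [i vi0] : exists i, v i 0 != 0.
  apply/existsP; apply: contraNT vn0; rewrite negb_exists => /forallP h.
  by apply/eqP/colP => i; rewrite mxE; apply/eqP/negPn.
have [n _ Anji] := irrA j i.
have := expmx_eigenvector _ _ _ n Av => /colP/(_ j); rewrite !mxE => e.
rewrite lt_neqAle v0 andbT eq_sym; apply/eqP => vj0; move: e.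
rewrite vj0 mulr0 => /eqP; rewrite psumr_eq0; last first.
  by move=> k _; rewrite mulr_ge0// expmx_ge0.
move=> /allP /(_ i); rewrite mem_index_enum => /(_ erefl) /=.
by rewrite mulf_eq0 (negbTE vi0) orbF gt_eqF.
Qed.

Lemma prob_vector_neq0 v : prob_vector v -> v != 0.
Proof.
move=> [_ v1]; apply/eqP => v0; move: v1; rewrite v0 big1 => [/eqP|i _].
  by rewrite eq_sym oner_eq0.
by rewrite mxE.
Qed.

(** With [t] the least ratio [v i 0 / w i 0], the vector [v - t *: w] is a nonnegative eigenvector
    with a zero coordinate, hence it is 0; the normalisation then forces [t = 1]. *)
Lemma irreducible_eigenvector_unique A v w lam :
  (forall i j, 0 <= A i j) -> irreducible_mx A ->
  prob_vector v -> prob_vector w ->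
  A *m v = lam *: v -> A *m w = lam *: w -> v = w.
Proof.
move=> A0 irrA pv pw Av Aw.
have v0 := irreducible_eigenvector_gt0 _ _ _ A0 irrA pv.1 (prob_vector_neq0 _ pv) Av.
have w0 := irreducible_eigenvector_gt0 _ _ _ A0 irrA pw.1 (prob_vector_neq0 _ pw) Aw.
have [i0 _] : exists i0 : 'I_l, true.
  have := prob_vector_neq0 _ pv; case: (pickP ('I_l)) => [i _|h]; first by exists i.
  by move=> /eqP; elim; apply/colP => i; have := h i.
case: (@arg_minP _ _ _ i0 predT (fun i => v i 0 / w i 0)) => // i _ hi.
set t := v i 0 / w i 0 in hi.
have vtw : v - t *: w = 0.
  apply/eqP/negPn/negP => vtw.
  have Avtw : A *m (v - t *: w) = lam *: (v - t *: w).
    by rewrite mulmxBr Av -scalemxAr Aw scalerBr scalerA mulrC -scalerA.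
  have vtw0 k : 0 <= (v - t *: w) k 0.
    by rewrite !mxE subr_ge0 -ler_pdivlMr// hi.
  have := irreducible_eigenvector_gt0 _ _ _ A0 irrA vtw0 vtw Avtw i.
  by rewrite !mxE /t divfK ?subrr ?ltxx// gt_eqF.
have /eqP := vtw; rewrite subr_eq0 => /eqP vE.
have := pv.2; rewrite vE; under eq_bigr do rewrite mxE.
by rewrite -mulr_sumr pw.2 mulr1 => ->; rewrite scale1r.
Qed.

(* A left eigenvector [u] for [z] satisfies [|z| |u| <= |u| A] entrywise;
   pairing with the positive right eigenvector [v] gives [|z| <= lam]. *)
Lemma spectral_radius_eigenvector A v lam : (0 < l)%N ->
  (forall i j, 0 <= A i j) -> (forall i, 0 < v i 0) -> A *m v = lam *: v ->
  spectral_radius A = lam.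
Proof.
move=> l0 A0 v0 Av.
have [i0 _] : exists i0 : 'I_l, true by exists (Ordinal l0).
have lam0 : 0 <= lam.
  have : 0 <= (lam *: v) i0 0.
    by rewrite -Av; apply: mulmx_ge0 => // i j; rewrite ord1 ltW.
  by rewrite mxE pmulr_lge0.
rewrite /spectral_radius; set E := (X in sup X).
have lamE : E lam.
  exists lam%:C%C; last by rewrite /Normc.normc/= expr0n addr0 sqrtr_sqr ger0_norm.
  (* [eigenvalue] concerns left eigenvectors, whereas [v] is a right one; it serves to show that
     [A - lam%:M] is not invertible. *)
  rewrite /= eigenvalue_map /eigenvalue /eigenspace kermx_eq0 row_free_unit.
  apply/negP => u.
  have : (A - lam%:M) *m v = 0 by rewrite mulmxBl Av mul_scalar_mx subrr.
  move=> /(congr1 (mulmx (invmx (A - lam%:M)))).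
  rewrite mulKmx// mulmx0 => /colP /(_ i0); rewrite mxE => h.
  by have := v0 i0; rewrite h ltxx.
have ubE : ubound E lam.
  move=> _ [z /eigenvalueP [u uA u0] <-].
  suff : `|z| <= lam%:C%C by rewrite normc_def lecR; case: z {uA}.
  have vC i : 0 < (v i 0)%:C%C by rewrite ltcR.
  pose S : R[i] := \sum_j `|u 0 j| * (v j 0)%:C%C.
  have [j0 uj0] : exists j, u 0 j != 0.
    apply/existsP; apply: contraNT u0; rewrite negb_exists => /forallP h.
    by apply/eqP/rowP => i; rewrite mxE; apply/eqP/negPn.
  have S0 : 0 < S.
    rewrite /S (bigD1 j0)//= ltr_pwDl ?mulr_gt0 ?normr_gt0//.
    by apply: sumr_ge0 => k _; rewrite mulr_ge0// ltW.
  rewrite -(ler_pM2r S0).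
  have -> : lam%:C%C * S = \sum_j (\sum_i `|u 0 i| * (A i j)%:C%C) * (v j 0)%:C%C.
    rewrite mulr_sumr.
    under [RHS]eq_bigr do rewrite mulr_suml.
    rewrite [RHS]exchange_big/=; apply: eq_bigr => i _.
    under eq_bigr do rewrite -mulrA -rmorphM/=.
    rewrite -mulr_sumr mulrCA; congr (_ * _).
    by have /colP/(_ i) := Av; rewrite !mxE -rmorphM/= => <-; rewrite rmorph_sum.
  rewrite mulr_sumr; apply: ler_sum => j _; rewrite mulrA ler_pM2r//.
  have /rowP/(_ j) := uA; rewrite !mxE -normrM => <-.
  apply: (le_trans (ler_norm_sum _ _ _)); apply: ler_sum => i _.
  by rewrite mxE normrM ler_pM// ger0_norm// ?lecR.
apply/eqP; rewrite eq_le; apply/andP; split.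
  by apply: ge_sup => //; exists lam.
by apply: sup_upper_bound => //; split; [exists lam|exists lam].
Qed.

Lemma ex_scale_le v w : (forall i, 0 < v i 0) -> (forall i, 0 <= w i 0) ->
  exists2 e : R, 0 < e & forall i, e * w i 0 <= v i 0.
Proof.
move=> v0 w0; pose s := 1 + \sum_i w i 0 / v i 0.
have h i : w i 0 / v i 0 <= s.
  rewrite /s (bigD1 i)//= addrCA lerDl addr_ge0// sumr_ge0// => k _.
  by rewrite divr_ge0// ltW.
have s0 : 0 < s by rewrite ltr_pwDl// sumr_ge0// => k _; rewrite divr_ge0// ltW.
exists s^-1; first by rewrite invr_gt0.
by move=> i; rewrite ler_pdivrMl// -ler_pdivrMr.
Qed.

(* Maximality of [lam] among the [lam] with [lam x <= A x] for some probability
   vector [x] forces equality. *)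
Lemma perron_eigenvector_exists A : (0 < l)%N ->
  (forall i j, 0 <= A i j) -> irreducible_mx A ->
  exists x lam, prob_vector x /\ A *m x = lam *: x.
Proof.
move=> l0 A0 irrA.
pose M := \sum_i \sum_j A i j.
have M0 : 0 <= M by apply: sumr_ge0 => i _; apply: sumr_ge0.
pose feas lam x := prob_vector x /\ forall i, lam * x i 0 <= (A *m x) i 0.
have feas_le lam x : feas lam x -> lam <= M.
  move=> [[x0 x1] h]; rewrite -[lam]mulr1 -x1 mulr_sumr.
  apply: ler_sum => i _; apply: (le_trans (h i)); rewrite mxE.
  apply: ler_sum => j _; rewrite ler_piMr//.
  by rewrite -x1 (bigD1 j)//= lerDl sumr_ge0.
(* A pair [(lam, x)] is coded as one row vector, with [lam] in coordinate 0, so that compactness of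
   boxes and the extreme value theorem apply. *)
pose unpack (z : 'rV[R]_l.+1) : 'cV[R]_l := \col_i z 0 (lift ord0 i).
(* The bound [M + 1] accommodates both [lam], at most [M], and the coordinates of [x], at most 1. *)
pose F := [set z : 'rV[R]_l.+1 |
  (forall i, `[0, M + 1]%classic (z 0 i)) /\ feas (z 0 0) (unpack z)].
have contc (i : 'I_l.+1) : continuous (fun z : 'rV[R]_l.+1 => z 0 i).
  by move=> z; apply: coord_continuous.
have contS (f : 'I_l -> 'rV[R]_l.+1 -> R) : (forall i, continuous (f i)) ->
    continuous (fun z => \sum_i f i z).
  move=> cf z; apply: (@cvg_big _ _ _ _ _ _ _ (nbhs z)) => [|i _].
    exact: add_continuous.
  exact: cf.
have clF : closed [set z : 'rV[R]_l.+1 | feas (z 0 0) (unpack z)].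
  have -> : [set z : 'rV[R]_l.+1 | feas (z 0 0) (unpack z)] =
     (\bigcap_(i : 'I_l)
       ((fun z : 'rV[R]_l.+1 => z 0 (lift ord0 i)) @^-1` [set t | 0 <= t])) `&`
     ((fun z : 'rV[R]_l.+1 => \sum_i z 0 (lift ord0 i)) @^-1` [set 1]) `&`
     (\bigcap_(i : 'I_l) ((fun z : 'rV[R]_l.+1 =>
        \sum_j A i j * z 0 (lift ord0 j) - z 0 0 * z 0 (lift ord0 i)) @^-1` [set t | 0 <= t])).
    apply/seteqP; split => z /=.
      move=> [[h1 h2] h3]; split; first split.
      - by move=> i _ /=; have := h1 i; rewrite mxE.
      - by rewrite -h2; apply: eq_bigr => i _; rewrite mxE.
      - move=> i _ /=; have := h3 i; rewrite !mxE subr_ge0 => /le_trans; apply.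
        by apply: ler_sum => j _; rewrite mxE.
    move=> [[h1 h2] h3]; split; first split.
    - by move=> i; have := h1 i I; rewrite mxE.
    - by rewrite -[RHS]h2; apply: eq_bigr => i _; rewrite mxE.
    - move=> i; have := h3 i I; rewrite /= !mxE subr_ge0 => /le_trans; apply.
      by apply: ler_sum => j _; rewrite mxE.
  apply: closedI; first apply: closedI.
  - apply: closed_bigI => i _.
    by apply: preimage_closed => [z _|]; [exact: contc|exact: closed_ge].
  - apply: preimage_closed => [z _|]; last exact: closed_eq.
    by apply: contS => i; exact: contc.
  - apply: closed_bigI => i _.
    apply: preimage_closed => [z _|]; last exact: closed_ge.
    apply: (@continuousB _ _ _ (fun z : 'rV[R]_l.+1 => \sum_j A i j * z 0 (lift ord0 j))).
      by apply: contS => j y; apply: continuousM; [exact: cst_continuous|exact: contc].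
    by apply: continuousM; exact: contc.
have cF : compact F.
  rewrite (_ : F = [set z : 'rV[R]_l.+1 | feas (z 0 0) (unpack z)] `&`
     [set z : 'rV[R]_l.+1 | forall i, `[0, M + 1]%classic (z 0 i)]); last first.
    by apply/seteqP; split => z [].
  rewrite setIC; apply: compact_closedI => //.
  by apply: (@rV_compact _ _ (fun=> `[0, M + 1]%classic)) => i; exact: segment_compact.
pose pack lam x : 'rV[R]_l.+1 := \row_i (if unlift ord0 i is Some j then x j 0 else lam).
have packF lam x : 0 <= lam -> feas lam x -> F (pack lam x).
  move=> lam0 fx; have lM := feas_le _ _ fx.
  have e0 : pack lam x 0 0 = lam by rewrite mxE unlift_none.
  have e1 j : pack lam x 0 (lift ord0 j) = x j 0 by rewrite mxE liftK.
  have ux : unpack (pack lam x) = x by apply/colP => i; rewrite mxE e1.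
  split; last by rewrite e0 ux.
  move=> i /=; rewrite in_itv/=; case: (unliftP ord0 i) => [j|] ->.
    rewrite e1 (fx.1.1 j)/= -[leLHS]add0r lerD//.
    by rewrite -fx.1.2 (bigD1 j)//= lerDl sumr_ge0// => k _; exact: fx.1.1.
  by rewrite e0 lam0/= -[leLHS]addr0 lerD.
have F0 : F !=set0.
  exists (pack 0 (const_mx l%:R^-1)); apply: packF => //; split; first split.
  - by move=> i; rewrite mxE invr_ge0.
  - under eq_bigr do rewrite mxE.
    by rewrite sumr_const card_ord -[X in X *+ _]mulr1 -mulrnAr mulVf// pnatr_eq0 -lt0n.
  - move=> i; rewrite mul0r; apply: mulmx_ge0 => // a b.
    by rewrite mxE invr_ge0.
have [z zF maxz] := @EVT_max_rV _ _ (fun z => z 0 0) F F0 cF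
  (continuous_subspaceT (contc _)).
move: zF; rewrite inE => -[zM [px hx]].
set lam := z 0 0 in maxz hx; set x := unpack z in px hx.
have lam0 : 0 <= lam by have := zM ord0; rewrite /= in_itv/= => /andP[].
have maxl lam' y : feas lam' y -> lam' <= lam.
  move=> fy; case: (leP 0 lam') => [l'0|/ltW l'0]; last exact: le_trans lam0.
  have := maxz (pack lam' y); rewrite inE => /(_ (packF _ _ l'0 fy)).
  by rewrite mxE unlift_none.
move: lam x px hx lam0 maxl {maxz} => lam x px hx lam0 maxl.
exists x, lam; split => //; apply/eqP; rewrite -subr_eq0; apply/negPn/negP => u0.
set u := A *m x - lam *: x in u0.
have u_ge0 i : 0 <= u i 0 by have := hx i; rewrite /u !mxE subr_ge0.
have [n hn] : exists n : 'I_l -> 'I_l -> nat, forall i j, 0 < (A ^+ n i j) i j.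
  have /choice[n hn] : forall ij : 'I_l * 'I_l, exists n, 0 < (A ^+ n) ij.1 ij.2.
    by move=> [i j]; have [n _ h] := irrA i j; exists n.
  by exists (fun i j => n (i, j)) => i j; exact: hn (i, j).
(* [B] has positive entries and commutes with [A]. If [u] is not 0, then
   [A *m (B *m x) - lam *: (B *m x) = B *m u] is positive in every coordinate, so [B *m x], once
   normalised, is feasible for some [lam + e], against maximality. *)
pose B : 'M[R]_l := \sum_i \sum_j A ^+ n i j.
have AB : A *m B = B *m A.
  rewrite /B mulmx_sumr mulmx_suml; apply: eq_bigr => i _.
  rewrite mulmx_sumr mulmx_suml; apply: eq_bigr => j _.
  by rewrite -[LHS]/(A * _) -[RHS]/(_ * A) -exprS -exprSr.
have B0 i j : 0 < B i j.
  rewrite /B summxE (bigD1 i)//= summxE (bigD1 j)//=.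
  rewrite -addrA ltr_pwDl// addr_ge0//.
    by apply: sumr_ge0 => k _; rewrite expmx_ge0.
  by apply: sumr_ge0 => k _; rewrite summxE sumr_ge0// => k' _; rewrite expmx_ge0.
have Bpos (y : 'cV[R]_l) : (forall i, 0 <= y i 0) -> y != 0 -> forall i, 0 < (B *m y) i 0.
  move=> y0 yn0 i.
  have [j yj] : exists j, y j 0 != 0.
    apply/existsP; apply: contraNT yn0; rewrite negb_exists => /forallP h.
    by apply/eqP/colP => k; rewrite mxE; apply/eqP/negPn.
  rewrite mxE (bigD1 j)//= ltr_pwDl//.
    by rewrite mulr_gt0// lt_neqAle eq_sym yj y0.
  by rewrite sumr_ge0// => k _; rewrite mulr_ge0// ltW.
have Bx0 := Bpos _ px.1 (prob_vector_neq0 _ px).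
have Bu0 := Bpos _ u_ge0 u0.
have [e e0 he] := ex_scale_le _ _ Bu0 (fun i => ltW (Bx0 i)).
pose S := \sum_i (B *m x) i 0.
have S0 : 0 < S.
  rewrite /S (bigD1 (Ordinal l0))//= ltr_pwDl// sumr_ge0// => k _; exact: ltW.
have : feas (lam + e) (S^-1 *: (B *m x)).
  split; first split.
  - by move=> i; rewrite mxE mulr_ge0// ?invr_ge0 ltW.
  - by under eq_bigr do rewrite mxE; rewrite -mulr_sumr mulVf// gt_eqF.
  - move=> i; have cE (a : R) (y : 'cV[R]_l) : (a *: y) i 0 = a * y i 0 by rewrite mxE.
    rewrite -scalemxAr !cE mulrCA ler_pM2l ?invr_gt0//.
    rewrite mulrDl -lerBrDl; apply: (le_trans (he i)).
    by rewrite /u mulmxBr !mulmxA -AB -mulmxA -scalemxAr [leLHS]mxE [X in _ + X]mxE cE.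
by move=> /maxl; rewrite gerDl leNgt e0.
Qed.

End perron_frobenius.

(** * Words and adic intervals *)

(** The word read in base [l], first letter most significant: it numbers the intervals of a
    generation from left to right, so that comparing endpoints becomes integer arithmetic. *)
Fixpoint word_nat {l : nat} (w : seq 'I_l) : nat :=
  if w is j :: s then (j * l ^ size s + word_nat s)%N else 0%N.

Section adic_intervals.
Context {R : realType} {l : nat}.
Implicit Types (s t : seq 'I_l).

Lemma word_nat_rcons s (j : 'I_l) : word_nat (rcons s j) = (word_nat s * l + j)%N.
Proof.
elim: s => [|i s IH] /=; first by rewrite muln1 addn0.
by rewrite IH size_rcons expnSr; ring.
Qed.

Lemma word_nat_lt s : (word_nat s < l ^ size s)%N.
Proof.
elim: s => [|i s IH] //=; rewrite expnS.
apply: (@leq_trans (i * l ^ size s + l ^ size s)); first by rewrite ltn_add2l.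
by rewrite -mulSnr leq_mul2r ltn_ord orbT.
Qed.

Lemma word_nat_inj s t : size s = size t -> word_nat s = word_nat t -> s = t.
Proof.
elim: s t => [|i s IH] [|j t] //= [st] e.
have l0 : (0 < l ^ size t)%N by rewrite expn_gt0 (leq_ltn_trans _ (ltn_ord i)).
have hs := word_nat_lt s; have ht := word_nat_lt t; rewrite st in e hs.
have ij : i = j :> nat.
  have := congr1 (divn^~ (l ^ size t)%N) e.
  by rewrite !divnMDl// !divn_small// !addn0.
congr cons; first exact: val_inj.
by apply: IH => //; move: e; rewrite ij => /addnI.
Qed.

Lemma word_nat_onto n k : (k < l ^ n)%N -> exists w : n.-tuple 'I_l, word_nat w = k.
Proof.
elim: n k => [|n IH] k; first by case: k => // _; exists [tuple].
move=> kl; have l0 : (0 < l ^ n)%N.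
  by rewrite lt0n; apply: contraTneq kl; rewrite expnS => ->; rewrite muln0.
have kd : (k %/ l ^ n < l)%N by rewrite ltn_divLR// -expnS.
have [w wk] := IH (k %% l ^ n)%N (ltn_pmod _ l0).
exists [tuple of Ordinal kd :: w] => /=.
by rewrite size_tuple wk -divn_eq.
Qed.

Lemma word_pointE n (w : n.-tuple 'I_l) :
  word_point R w = (word_nat w)%:R / l%:R ^+ n.
Proof.
have [l0|l0] := posnP l.
  have n0 : n = 0%N.
    case: n w => // n w; have := leq_ltn_trans (leq0n _) (ltn_ord (thead w)).
    by rewrite [X in (_ < X)%N -> _]l0.
  by subst n; rewrite (tuple0 w) /word_point big_ord0/= mul0r.
have lR : (l%:R : R) != 0 by rewrite pnatr_eq0 -lt0n.
elim: n w => [w|n IH w]; first by rewrite (tuple0 w) /word_point big_ord0/= mul0r.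
case/tupleP: w => j w; rewrite [word_nat _]/= [X in (_ * l ^ X)%N]size_tuple.
rewrite /word_point big_ord_recl tnth0 expr1.
under eq_bigr do rewrite tnthS lift0 exprSr invfM mulrA.
rewrite -mulr_suml -/(word_point R w) IH natrD natrM natrX mulrDl exprSr; congr (_ + _).
  by rewrite invfM mulrA mulfK// expf_neq0.
by rewrite invfM mulrA.
Qed.

Lemma adic_itvE n (w : n.-tuple 'I_l) : adic_itv R w =
  `[(word_nat w)%:R / l%:R ^+ n, (word_nat w).+1%:R / l%:R ^+ n[%classic.
Proof.
by rewrite /adic_itv word_pointE -[_.+1]addn1 natrD mulrDl mul1r.
Qed.

Lemma measurable_adic_itv n (w : n.-tuple 'I_l) :
  measurable (adic_itv R w : set (measurableTypeR R)).
Proof. exact: measurable_itv. Qed.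

End adic_intervals.

Section adic_partition.
Context {R : realType} {l : nat}.
Hypothesis l0 : (0 < l)%N.

Local Lemma lR0 : 0 < l%:R :> R.
Proof. by rewrite ltr0n. Qed.

Lemma in_adic_itv n (w : n.-tuple 'I_l) (x : R) :
  adic_itv R w x <-> (word_nat w)%:R <= x * l%:R ^+ n < (word_nat w).+1%:R.
Proof.
rewrite adic_itvE /= in_itv/=.
by rewrite ler_pdivrMr ?ltr_pdivlMr ?exprn_gt0 ?lR0.
Qed.

Lemma adic_itv_uniq n (w w' : n.-tuple 'I_l) (x : R) :
  adic_itv R w x -> adic_itv R w' x -> w = w'.
Proof.
move=> /in_adic_itv/andP[a b] /in_adic_itv/andP[c d].
apply/val_inj/word_nat_inj; first by rewrite !size_tuple.
apply/eqP; rewrite eqn_leq -2!(ltnS (word_nat _)) -2!(ltr_nat R).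
by rewrite (le_lt_trans a d) (le_lt_trans c b).
Qed.

Lemma adic_itv_exists n (x : R) : 0 <= x < 1 -> exists w : n.-tuple 'I_l, adic_itv R w x.
Proof.
move=> /andP[x0 x1].
have xl : 0 <= x * l%:R ^+ n by rewrite mulr_ge0// exprn_ge0// ltW// lR0.
have /andP[h1 h2] := truncn_itv xl.
have [|w wk] := @word_nat_onto l n (Num.truncn (x * l%:R ^+ n)).
  rewrite -(ltr_nat R) (le_lt_trans h1)// natrX -[ltRHS]mul1r.
  by rewrite ltr_pM2r// exprn_gt0// lR0.
by exists w; apply/in_adic_itv; rewrite wk h1 h2.
Qed.

Lemma adic_itv_atE n (w : n.-tuple 'I_l) (x : R) : adic_itv R w x ->
  adic_itv_at l n x = adic_itv R w.
Proof.
move=> wx; rewrite /adic_itv_at; case: xgetP => [I -> [[w' ->] w'x]|].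
  by rewrite (adic_itv_uniq _ _ _ _ wx w'x).
by move=> /(_ (adic_itv R w)); elim; split => //; exists w.
Qed.

Lemma trivIset_adic_itv n : trivIset setT (fun w : n.-tuple 'I_l => adic_itv R w).
Proof.
by move=> w w' _ _ [x [xw xw']]; exact: adic_itv_uniq xw xw'.
Qed.

End adic_partition.

(** * A measure with prescribed cylinder weights *)

Lemma sum_tuple_rcons (R : nmodType) (T : finType) n (f : n.+1.-tuple T -> R) :
  \sum_w f w = \sum_(w : n.-tuple T) \sum_(j : T) f (rcons_tuple w j).
Proof.
rewrite pair_big/= (reindex (fun p : n.-tuple T * T => rcons_tuple p.1 p.2))//=.
apply: onW_bij; apply: inj_card_bij.
  by move=> [w i] [w' j] /= /(congr1 val) /= /rcons_inj [/val_inj -> ->].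
by rewrite card_prod !card_tuple expnSr.
Qed.

(** Meant for the words of one generation whose interval straddles a given point. *)
Lemma sum_at_most_one_le (R : numDomainType) (T : finType) (Q : pred T)
    (f : T -> R) (e : R) :
  0 <= e -> (forall w, f w <= e) -> (forall w w', Q w -> Q w' -> w = w') ->
  \sum_(w | Q w) f w <= e.
Proof.
move=> e0 fe Q1; case: (pickP Q) => [w Qw|Q0]; last by rewrite big_pred0.
rewrite (bigD1 w)//= big_pred0 ?addr0// => w'.
by apply/negbTE/negP => /andP[/Q1 h /eqP]; apply; apply: h.
Qed.

Section weight_cdf.
Context {R : realType} {l : nat} (W : seq 'I_l -> R).
Hypothesis l0 : (0 < l)%N.
Hypothesis W_ge0 : forall s, 0 <= W s.
Hypothesis W_nil : W [::] = 1.
Hypothesis W_rcons : forall s, \sum_j W (rcons s j) = W s.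
Hypothesis W_small :
  forall e, 0 < e -> exists n, forall w : n.-tuple 'I_l, W w <= e.

Let pt {n} (w : n.-tuple 'I_l) : R := word_point R w.
(* The masses of the adic intervals of generation [n] that meet [`]-oo, x[], resp.
   lie in [`]-oo, x]]; they bound the distribution function at [x] from above and below. *)
Let F n x := \sum_(w : n.-tuple 'I_l | pt w < x) W w.
Let G n x := \sum_(w : n.-tuple 'I_l | pt w + l%:R ^- n <= x) W w.

Let lR0 : 0 < l%:R :> R. Proof. by rewrite ltr0n. Qed.
Let lX0 n : 0 < l%:R ^+ n :> R. Proof. by rewrite exprn_gt0. Qed.
Let lV0 n : 0 < l%:R ^- n :> R. Proof. by rewrite invr_gt0. Qed.

Let pt_rcons n (w : n.-tuple 'I_l) j :
  pt (rcons_tuple w j) = pt w + j%:R * l%:R ^- n.+1.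
Proof.
rewrite {1}/pt word_pointE/= word_nat_rcons natrD natrM exprSr mulrDl; congr (_ + _).
by rewrite -mulf_div divff ?mulr1 ?gt_eqF// /pt word_pointE.
Qed.

Let F_decr x : nonincreasing_seq (F^~ x).
Proof.
apply/nonincreasing_seqP => n; rewrite /F big_mkcond sum_tuple_rcons [leRHS]big_mkcond/=.
apply: ler_sum => w _; case: ifPn => [_|wx].
  by rewrite -(W_rcons w); apply: ler_sum => j _; case: ifP.
rewrite big1// => j _; rewrite pt_rcons ifF//; apply/negbTE; move: wx.
rewrite -!leNgt => /le_trans; apply; rewrite lerDl mulr_ge0// ltW//.
Qed.

Let G_incr x : nondecreasing_seq (G^~ x).
Proof.
apply/nondecreasing_seqP => n; rewrite /G big_mkcond [leRHS]big_mkcond sum_tuple_rcons/=.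
apply: ler_sum => w _; case: ifPn => [wx|_]; last first.
  by apply: sumr_ge0 => j _; case: ifP.
rewrite -(W_rcons w); apply: ler_sum => j _; rewrite pt_rcons ifT//.
apply: le_trans wx; rewrite -addrA lerD2l -[X in _ + X]mul1r -mulrDl.
rewrite ler_pdivrMr// exprSr mulrA mulVf ?gt_eqF// mul1r natr1 ler_nat.
exact: ltn_ord.
Qed.

(** Both sides are compared at generation [maxn m n], by monotonicity in the generation. *)
Let G_le_F m n x : G m x <= F n x.
Proof.
apply: le_trans (F_decr x _ _ (leq_maxr m n)).
apply: (le_trans (G_incr x _ _ (leq_maxl m n))).
rewrite /G /F [leLHS]big_mkcond [leRHS]big_mkcond; apply: ler_sum => w _.
case: ifPn => [wx|_]; last by case: ifP.
by rewrite ifT// (lt_le_trans _ wx)// ltrDl.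
Qed.

(** The words counted by [F] but not by [G] have intervals containing [x], so there is at most
    one. *)
Let F_le_G n e x : 0 <= e -> (forall w : n.-tuple 'I_l, W w <= e) ->
  F n x <= G n x + e.
Proof.
move=> e0 We; rewrite /F (bigID (fun w => pt w + l%:R ^- n <= x))/= lerD//.
  rewrite [leLHS]big_mkcond /G [leRHS]big_mkcond; apply: ler_sum => w _.
  by case: ifPn => [/andP[_ ->]//|_]; case: ifP.
apply: sum_at_most_one_le => // w w' /andP[a]; rewrite -ltNge => b /andP[c].
rewrite -ltNge => d; apply: (adic_itv_uniq l0 _ w w' x).
  by rewrite /adic_itv /= in_itv/= (ltW a).
by rewrite /adic_itv /= in_itv/= (ltW c).
Qed.

(** [[x, y[] is no longer than an interval of generation [n], hence contains at most one left
    endpoint of that generation. *)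
Let F_shift n e x y : 0 <= e -> (forall w : n.-tuple 'I_l, W w <= e) ->
  y <= x + l%:R ^- n -> F n y <= F n x + e.
Proof.
move=> e0 We xy; rewrite /F (bigID (fun w => pt w < x))/= lerD//.
  rewrite [leLHS]big_mkcond [leRHS]big_mkcond; apply: ler_sum => w _.
  by case: ifPn => [/andP[_ ->]//|_]; case: ifP.
have key (w w' : n.-tuple 'I_l) : pt w < y -> x <= pt w' -> (word_nat w <= word_nat w')%N.
  move=> a b; rewrite -ltnS -(ltr_nat R).
  have : pt w < pt w' + l%:R ^- n.
    by apply: (lt_le_trans a); apply: (le_trans xy); rewrite lerD2r.
  by rewrite /pt !word_pointE -[X in _ + X]mul1r -mulrDl ltr_pM2r// natr1.
apply: sum_at_most_one_le => // w w' /andP[a]; rewrite -leNgt => b /andP[c].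
rewrite -leNgt => d; apply/val_inj/word_nat_inj; first by rewrite !size_tuple.
by apply/eqP; rewrite eqn_leq !key.
Qed.

Definition weight_cdf x := inf (range (F^~ x)).

Let cdf_le n x : weight_cdf x <= F n x.
Proof.
by apply: ge_inf; [exists (G 0 x) => _ [m _ <-]|exists n].
Qed.

Let cdf_ge n x : G n x <= weight_cdf x.
Proof.
by apply: lb_le_inf; [exists (F 0 x), 0%N|move=> _ [m _ <-]].
Qed.

Let cdf_nd : nondecreasing weight_cdf.
Proof.
move=> x y xy; apply: lb_le_inf; first by exists (F 0 y), 0%N.
move=> _ [n _ <-]; apply: (le_trans (cdf_le n x)).
rewrite /F [leLHS]big_mkcond [leRHS]big_mkcond; apply: ler_sum => w _.
by case: ifPn => [wx|_]; [rewrite (lt_le_trans wx xy)|case: ifP].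
Qed.

(** A uniform modulus of continuity, used for right continuity and again to exclude atoms. One half
    of [e] pays for the shift, the other for the gap between [F] and [G]. *)
Let cdf_shift e : 0 < e -> exists2 h, 0 < h &
  forall x y, y <= x + h -> weight_cdf y <= weight_cdf x + e.
Proof.
move=> e0; have [|n Wn] := W_small (e / 2); first by rewrite divr_gt0.
exists (l%:R ^- n) => // x y xy.
apply: (le_trans (cdf_le n y)).
have e20 : 0 <= e / 2 by rewrite divr_ge0// ltW.
apply: (le_trans (F_shift _ _ _ _ e20 Wn xy)).
rewrite {2}(splitr e) addrA lerD2r.
apply: (le_trans (F_le_G _ _ x e20 Wn)).
by rewrite lerD2r.
Qed.

Let cdf_rc : right_continuous weight_cdf.
Proof.
move=> x; apply/cvgrPdist_le => e e0.
have [h h0 H] := cdf_shift e e0.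
near=> y.
have xy : x < y by near: y; exact: nbhs_right_gt.
have yx : y <= x + h by near: y; apply: nbhs_right_le; rewrite ltrDl.
rewrite distrC ger0_norm ?subr_ge0 ?cdf_nd ?(ltW xy)// lerBlDl H//.
Unshelve. all: by end_near. Qed.

#[local] HB.instance Definition _ := isCumulative.Build R _ R weight_cdf cdf_nd cdf_rc.

(** No interval of generation [n] straddles a point of the grid, so there [F n] and [G n] coincide
    and squeeze the distribution function. *)
Let cdf_adic n k : weight_cdf (k%:R / l%:R ^+ n) =
  \sum_(w : n.-tuple 'I_l | (word_nat w < k)%N) W w.
Proof.
have FE : F n (k%:R / l%:R ^+ n) = \sum_(w : n.-tuple 'I_l | (word_nat w < k)%N) W w.
  by apply: eq_bigl => w; rewrite /pt word_pointE ltr_pM2r// ltr_nat.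
have GE : G n (k%:R / l%:R ^+ n) = \sum_(w : n.-tuple 'I_l | (word_nat w < k)%N) W w.
  apply: eq_bigl => w.
  by rewrite /pt word_pointE -[X in _ + X]mul1r -mulrDl ler_pM2r// natr1 ler_nat.
by apply/eqP; rewrite eq_le -{1}FE cdf_le -GE cdf_ge.
Qed.

Let cdf_le0 x : x <= 0 -> weight_cdf x = 0.
Proof.
move=> x0; apply/eqP; rewrite eq_le; apply/andP; split.
  apply: le_trans (cdf_le 0 x) _; rewrite /F big_pred0// => w; apply/negbTE.
  by rewrite -leNgt /pt word_pointE (le_trans x0)// divr_ge0// ltW.
by apply: le_trans (cdf_ge 0 x); apply: sumr_ge0.
Qed.

Let cdf_ge1 x : 1 <= x -> weight_cdf x = 1.
Proof.
move=> x1; apply/eqP; rewrite eq_le; apply/andP; split.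
  apply: le_trans (cdf_le 0 x) _; rewrite /F big_mkcond/= (big_pred1 [tuple])/=.
    by rewrite W_nil; case: ifP.
  by move=> w; rewrite (tuple0 w)/= [RHS]eqxx.
apply: le_trans (cdf_ge 0 x); rewrite /G (big_pred1 [tuple]) ?W_nil// => w /=.
by rewrite (tuple0 w) [RHS]eqxx /pt word_pointE mul0r add0r expr0 invr1 x1.
Qed.

Let cdf_Ny : weight_cdf @ -oo --> (0 : R).
Proof.
apply: cvg_near_cst; near=> x; apply: cdf_le0.
by near: x; exact: nbhs_ninfty_le.
Unshelve. all: by end_near. Qed.

Let cdf_y : weight_cdf @ +oo --> (1 : R).
Proof.
apply: cvg_near_cst; near=> x; apply: cdf_ge1.
by near: x; exact: nbhs_pinfty_ge.
Unshelve. all: by end_near. Qed.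

#[local] HB.instance Definition _ :=
  isCumulativeBounded.Build R 0 1 weight_cdf cdf_Ny cdf_y.

Let mu : probability (measurableTypeR R) R := lebesgue_stieltjes_measure weight_cdf.

Let mu_oc a b : a <= b -> mu `]a, b]%classic = (weight_cdf b - weight_cdf a)%:E.
Proof.
move=> ab; rewrite /mu /= /lebesgue_stieltjes_measure /measure_extension.
by rewrite measurable_mu_extE/=; [rewrite wlength_itv_bnd|exact: is_ocitv].
Qed.

(** The Stieltjes measure is known on []a, b]] and the adic intervals are [[a, b[]; null singletons
    reconcile the two. *)
Let mu_set1 x : mu [set x] = 0%E.
Proof.
apply/eqP; rewrite eq_le measure_ge0 andbT; apply/lee_addgt0Pr => e e0.
rewrite add0e; have [h h0 H] := cdf_shift e e0.
apply: (@le_trans _ _ (mu `]x - h, x]%classic)).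
  apply: le_measure; rewrite ?inE//.
  by move=> _ /= ->; rewrite in_itv/= lexx andbT ltrBlDr ltrDl.
rewrite mu_oc; last by rewrite gerBl ltW.
by rewrite lee_fin lerBlDl H// subrK.
Qed.

Let mu_co a b : a < b -> mu `[a, b[%classic = (weight_cdf b - weight_cdf a)%:E.
Proof.
move=> ab; rewrite -mu_oc ?(ltW ab)//.
have e1 : mu `[a, b]%classic = mu `[a, b[%classic.
  rewrite -(setUitv1 true) ?bnd_simp ?(ltW ab)// measureU//=; last first.
    by rewrite -subset0 => x /= [+ xb]; rewrite xb in_itv/= ltxx andbF.
  by rewrite mu_set1 adde0.
have e2 : mu `[a, b]%classic = mu `]a, b]%classic.
  rewrite -(setU1itv false) ?bnd_simp ?(ltW ab)// measureU//=; last first.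
    by rewrite -subset0 => x /= [xa]; rewrite xa in_itv/= ltxx.
  by rewrite mu_set1 add0e.
by rewrite -e1 e2.
Qed.

Lemma measure_of_weights : exists mu : probability (measurableTypeR R) R,
  mu `[0, 1[%classic = 1%E /\
  forall n (w : n.-tuple 'I_l), mu (adic_itv R w) = (W w)%:E.
Proof.
exists mu; split; first by rewrite mu_co// cdf_ge1// cdf_le0// subr0.
move=> n w; rewrite adic_itvE mu_co ?ltr_pM2r ?ltr_nat// !cdf_adic; congr EFin.
rewrite (bigD1 w)//=; apply/eqP; rewrite subr_eq; apply/eqP; congr (_ + _).
apply: eq_bigl => w'; rewrite ltnS leq_eqVlt.
have [->|ww'] := eqVneq w' w; first by rewrite ltnn andbF.
rewrite andbT; case: eqVneq => //= h.
by case/eqP : ww'; apply/val_inj/word_nat_inj => //; rewrite !size_tuple.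
Qed.

End weight_cdf.

(** * Hausdorff measures *)

Section hausdorff_measures.
Context {R : realType}.
Implicit Types (A B U : set R) (s t delta : R).

Lemma diam_set0 : diam (set0 : set R) = -oo%E.
Proof.
rewrite /diam (_ : [set _ | _ in _] = set0) ?ereal_sup0//.
by rewrite -subset0 => _ [z [[]]].
Qed.

Lemma diam_le U (h : R) :
  (forall x y, U x -> U y -> `|x - y| <= h) -> (diam U <= h%:E)%E.
Proof.
by move=> Uh; apply: ge_ereal_sup => _ [[x y] [/= Ux Uy] <-]; rewrite lee_fin Uh.
Qed.

Lemma le_diam U x y : U x -> U y -> (`|x - y|%:E <= diam U)%E.
Proof. by move=> Ux Uy; rewrite /diam; apply: ereal_sup_ubound; exists (x, y). Qed.

Lemma gaugeE s U : U !=set0 -> gauge s U = (diam U `^ s)%E.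
Proof. by move=> /set0P/eqP U0; rewrite /gauge; case: pselect. Qed.

Lemma gauge_ge0 s U : (0 <= gauge s U)%E.
Proof. by rewrite /gauge; case: (pselect (U = set0)) => // h; exact: poweR_ge0. Qed.

Lemma gauge_set0 s : gauge s (set0 : set R) = 0%E.
Proof. by rewrite /gauge; case: pselect. Qed.

Lemma gauge_le s U (h : R) : 0 <= s -> 0 <= h -> (diam U <= h%:E)%E ->
  (gauge s U <= (h `^ s)%:E)%E.
Proof.
move=> s0 h0 Uh; have [->|/set0P[x Ux]] := eqVneq U set0.
  by rewrite gauge_set0 lee_fin powR_ge0.
rewrite gaugeE; last by exists x.
have d0 : (0 <= diam U)%E by have := le_diam U x x Ux Ux; rewrite subrr normr0.
rewrite -poweR_EFin gt0_ler_poweR// in_itv/= ?leey ?andbT//.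
Qed.

(* [gauge] with the value [+oo] on sets of large diameter, so that the
   Hausdorff premeasure becomes an instance of [mu_ext] *)
Let pgauge s delta (U : set (g_sigma_algebraType (setT : set (set R)))) :=
  if (diam (U : set R) <= delta%:E)%E then gauge s (U : set R) else +oo%E.

Let pgauge_ge0 s delta U : (0 <= pgauge s delta U)%E.
Proof. by rewrite /pgauge; case: ifP => // _; exact: gauge_ge0. Qed.

(** [mu_ext] uses measurable covers, which is no restriction in the sigma-algebra generated by all
    sets. A cover containing too wide a set has sum [+oo], so it does not affect the infimum. *)
Let hausdorff_premeasureE s delta A :
  hausdorff_premeasure s delta A = mu_ext (pgauge s delta) A.
Proof.
apply/eqP; rewrite eq_le; apply/andP; split; apply: le_ereal_inf_tmp.
  move=> _ [U [_ AU] <-].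
  have [[i ioo]|Ud] := pselect (exists i, ~ (diam (U i : set R) <= delta%:E)%E).
    rewrite (eseries_pinfty (k := i)) ?leey//.
      by move=> n _; rewrite -ltNye (lt_le_trans _ (pgauge_ge0 _ _ _)).
    by rewrite /pgauge; case: ifP.
  have {}Ud i : (diam (U i : set R) <= delta%:E)%E.
    by apply: contrapT => h; apply: Ud; exists i.
  apply: ereal_inf_lbound; exists U => //.
  by apply: eq_eseriesr => i _; rewrite /pgauge Ud.
move=> _ [U [Ud AU] <-]; apply: ereal_inf_lbound; exists U.
  by split => // i; apply: sub_sigma_algebra.
by apply: eq_eseriesr => i _; rewrite /pgauge Ud.
Qed.

Lemma hausdorff_premeasure_ge0 s delta A : (0 <= hausdorff_premeasure s delta A)%E.
Proof. by rewrite hausdorff_premeasureE; apply: mu_ext_ge0. Qed.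

Lemma le_hausdorff_premeasure s delta A B : A `<=` B ->
  (hausdorff_premeasure s delta A <= hausdorff_premeasure s delta B)%E.
Proof.
by move=> AB; rewrite !hausdorff_premeasureE; exact: (le_mu_ext (pgauge s delta) AB).
Qed.

Lemma hausdorff_premeasure_bigcup s delta (A : nat -> set R) :
  (hausdorff_premeasure s delta (\bigcup_k A k) <=
   \sum_(k <oo) hausdorff_premeasure s delta (A k))%E.
Proof.
rewrite (_ : hausdorff_premeasure s delta = mu_ext (pgauge s delta)); last first.
  by apply/funext => B; exact: hausdorff_premeasureE.
exact: (@mu_ext_sigma_subadditive _ (g_sigma_algebraType (setT : set (set R))) _ _
  (pgauge_ge0 s delta) A).
Qed.

Lemma hausdorff_premeasure_le_sum s delta A (I : finType) (Q : pred I)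
    (U : I -> set R) :
  (forall i, diam (U i) <= delta%:E)%E -> A `<=` \bigcup_(i in [set i | Q i]) U i ->
  (hausdorff_premeasure s delta A <= \sum_(i | Q i) gauge s (U i))%E.
Proof.
(* The finite cover is continued by empty sets: their diameter [-oo] respects every [delta] and
   their gauge is 0. *)
move=> Ud AU; pose V k := nth set0 [seq U i | i <- enum Q] k.
apply: (@le_trans _ _ (\sum_(k <oo) gauge s (V k))%E).
  apply: ereal_inf_lbound; exists V => //; split.
    move=> k; rewrite /V; case: (ltnP k (size [seq U i | i <- enum Q])) => kn.
      by move/(mem_nth set0) : kn => /mapP[i _ ->].
    by rewrite nth_default// diam_set0 leNye.
  move=> x /AU [i /= Qi Ux]; exists (index i (enum Q)) => //.
  by rewrite /V (nth_map i) ?nth_index ?index_mem ?mem_enum.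
rewrite (@lim_near_cst _ _ _ _ _ (\sum_(i | Q i) gauge s (U i))%E)//.
near=> n.
have ns : (size [seq U i | i <- enum Q] <= n)%N by near: n; exact: nbhs_infty_ge.
rewrite (big_cat_nat (leq0n _) ns)//= [X in (_ + X)%E]big1_seq ?adde0; last first.
  move=> k; rewrite mem_index_iota => /andP[_ /andP[kn _]].
  by rewrite /V nth_default ?gauge_set0.
by rewrite -(big_nth set0 xpredT) big_map big_enum.
Unshelve. all: by end_near. Qed.

Lemma hausdorff_premeasure_le s delta A : 0 < delta ->
  (hausdorff_premeasure s delta A <= hausdorff_measure s A)%E.
Proof. by move=> d0; apply: ereal_sup_ubound; exists delta. Qed.

Lemma hausdorff_measure_le s A (x : \bar R) :
  (forall delta, 0 < delta -> (hausdorff_premeasure s delta A <= x)%E) ->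
  (hausdorff_measure s A <= x)%E.
Proof. by move=> h; apply: ge_ereal_sup => _ [delta /= d0 <-]; exact: h. Qed.

Lemma hausdorff_measure_ge0 s A : (0 <= hausdorff_measure s A)%E.
Proof.
exact: le_trans (hausdorff_premeasure_ge0 s 1 A) (hausdorff_premeasure_le s 1 A ltr01).
Qed.

Lemma le_hausdorff_measure s A B : A `<=` B ->
  (hausdorff_measure s A <= hausdorff_measure s B)%E.
Proof.
move=> AB; apply: hausdorff_measure_le => d d0.
exact: le_trans (le_hausdorff_premeasure s d A B AB) (hausdorff_premeasure_le s d B d0).
Qed.

(** * The mass distribution principle *)

Section mass_distribution.
Variables (mu : probability (measurableTypeR R) R) (s M : R).
Hypotheses (M0 : 0 < M) (s0 : 0 < s).
Hypothesis growth : forall x d, 0 <= d ->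
  (mu `[(x - d)%R, (x + d)%R]%classic <= (M * d `^ s)%:E)%E.

(** Hausdorff covers consist of arbitrary sets, so [U] is replaced by the closed interval of radius
    [diam U] about one of its points. Since [diam U <= 1], lowering the exponent from [s] to [t]
    only enlarges the power. *)
Lemma gauge_hull t U : 0 <= t <= s -> (diam U <= 1%:E)%E ->
  exists V : set (measurableTypeR R),
    [/\ measurable V, U `<=` V & (mu V <= M%:E * gauge t U)%E].
Proof.
move=> /andP[t0 ts] U1.
have [->|/set0P[x Ux]] := eqVneq U set0.
  by exists set0; split => //; rewrite measure0 mule_ge0 ?gauge_ge0 ?lee_fin ?ltW.
have d0 : (0 <= diam U)%E by have := le_diam U x x Ux Ux; rewrite subrr normr0.
have [d dE] : exists d, diam U = d%:E.
  exists (fine (diam U)); rewrite fineK// fin_numElt (lt_le_trans _ d0)//=.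
  by rewrite (le_lt_trans U1)// ltry.
exists `[(x - d)%R, (x + d)%R]%classic; split.
- exact: measurable_itv.
- move=> y Uy; have := le_diam U x y Ux Uy; rewrite dE lee_fin distrC => h.
  by rewrite /= in_itv/= -ler_distl.
- rewrite dE !lee_fin in d0 U1.
  apply: (le_trans (growth x d d0)).
  rewrite gaugeE; last by exists x.
  rewrite dE poweR_EFin -EFinM lee_fin ler_pM2l//.
  (* For a singleton the left side is 0 because [s] is positive, whichever value 0 to the power [t]
     takes. *)
  have [->|dn0] := eqVneq d 0; first by rewrite (powR0 (lt0r_neq0 s0)) powR_ge0.
  by apply: ger_powR => //; rewrite lt_neqAle eq_sym dn0 d0.
Qed.

(** Scale 1 already suffices; in this form the bound also controls finite covers by sets of a fixed
    size, hence covering numbers. *)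
Lemma mass_distribution_premeasure t (A : set (measurableTypeR R)) : 0 <= t <= s ->
  measurable A -> (mu A <= M%:E * hausdorff_premeasure t 1 A)%E.
Proof.
move=> ts mA; rewrite -lee_pdivrMl//.
apply: le_ereal_inf_tmp => _ [U [Ud AU] <-].
have [V hV] := choice (fun i => gauge_hull t (U i) ts (Ud i)).
rewrite lee_pdivrMl//.
apply: (@le_trans _ _ (\sum_(i <oo) mu (V i))%E).
  apply: measure_sigma_subadditive => //.
  - by move=> i; have [] := hV i.
  - by move=> x /AU[i _ Ux]; exists i => //; have [_ + _] := hV i; apply.
rewrite -nneseriesZl//; last by move=> i _; exact: gauge_ge0.
by apply: lee_nneseries => // i _; have [] := hV i.
Qed.

Lemma mass_distribution t (A : set (measurableTypeR R)) : 0 <= t <= s ->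
  measurable A -> (mu A <= M%:E * hausdorff_measure t A)%E.
Proof.
move=> ts mA; apply: (le_trans (mass_distribution_premeasure t A ts mA)).
by rewrite lee_pmul2l// hausdorff_premeasure_le.
Qed.

Lemma hausdorff_dim_ge (A : set (measurableTypeR R)) : measurable A -> (0 < mu A)%E ->
  (s%:E <= hausdorff_dim A)%E.
Proof.
move=> mA muA; apply: le_ereal_inf_tmp => _ [t [t0 At] <-].
rewrite lee_fin leNgt; apply/negP => ts.
have := mass_distribution t A; rewrite t0 (ltW ts) => /(_ erefl mA).
by rewrite At mule0 leNgt muA.
Qed.

End mass_distribution.

End hausdorff_measures.

(** * Regular adic measures *)

Definition adic_regular (R : realType) (l : nat) (lam C : R)
    (mu : probability (measurableTypeR R) R) :=
  [/\ mu `[0%R, 1%R[%classic = 1%E, 1 < lam, 1 <= C,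
    forall n (w : n.-tuple 'I_l), (mu (adic_itv R w) <= (C * lam ^- n)%:E)%E &
    forall n (w : n.-tuple 'I_l), (0 < mu (adic_itv R w))%E ->
      ((C^-1 * lam ^- n)%:E <= mu (adic_itv R w))%E].

Lemma near_geometric_lt (R : realType) (a c e : R) : 1 < a -> 0 < e ->
  \forall n \near \oo, c * a ^- n < e.
Proof.
move=> a1 e0; have a0 := lt_trans ltr01 a1.
have : (c * a ^- n @[n --> \oo] --> c * 0).
  apply: cvgM; first exact: cvg_cst.
  under eq_fun do rewrite -exprVn.
  by apply: cvg_expr; rewrite ger0_norm ?invf_lt1// invr_ge0 ltW.
by rewrite mulr0 => /cvgr_lt; apply.
Qed.

Section adic_scale.
Context {R : realType} (l : nat).
Hypothesis l2 : (2 <= l)%N.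

Let l1 : 1 < l%:R :> R. Proof. by rewrite ltr1n. Qed.
Let lR0 : 0 < l%:R :> R. Proof. exact: lt_trans l1. Qed.

Lemma adic_scale (h : R) : 0 < h < 1 ->
  exists n, l%:R ^- n.+1 <= h < l%:R ^- n.
Proof.
move=> /andP[h0 h1].
have ex : exists n, l%:R ^- n.+1 <= h.
  exists (Num.truncn h^-1); rewrite -[leRHS]invrK lef_pV2 ?posrE ?invr_gt0 ?exprn_gt0//.
  apply/ltW/(lt_trans (truncnS_gt h^-1)); rewrite -natrX ltr_nat.
  exact: ltn_expl.
exists (ex_minn ex); case: ex_minnP => -[|n] hn min; rewrite hn /=.
  by rewrite expr0 invr1.
by rewrite ltNge; apply/negP => /min; rewrite ltnn.
Qed.

Lemma powR_adic (lam : R) n : 0 < lam ->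
  (l%:R ^- n) `^ (ln lam / ln l%:R) = lam ^- n.
Proof.
move=> lam0; rewrite -!powR_invn ?ltW// -powRrM mulrC powRrM; congr (_ `^ _).
by rewrite /powR gt_eqF// divfK ?lnK ?posrE// gt_eqF// ln_gt0.
Qed.

End adic_scale.

(** * The support in terms of adic intervals *)

Section adic_support.
Context {R : realType} {l : nat}.
Variable mu : probability (measurableTypeR R) R.
Hypothesis l2 : (2 <= l)%N.
Hypothesis mu01 : mu `[0%R, 1%R[%classic = 1%E.

Let l0 : (0 < l)%N. Proof. exact: leq_trans l2. Qed.
Let l1 : 1 < l%:R :> R. Proof. by rewrite ltr1n. Qed.
Let lR0 : 0 < l%:R :> R. Proof. exact: lt_trans l1. Qed.
Let lV0 n : 0 < l%:R ^- n :> R. Proof. by rewrite invr_gt0 exprn_gt0. Qed.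

Lemma measure_outside_adic (B : set (measurableTypeR R)) : measurable B ->
  B `&` `[0, 1[%classic = set0 -> mu B = 0%E.
Proof.
move=> mB B01; apply/eqP; rewrite eq_le measure_ge0 andbT.
have : mu (~` `[0, 1[%classic) = 0%E.
  by rewrite probability_setC ?mu01 ?subee//; exact: measurable_itv.
move=> <-; apply: le_measure; rewrite ?inE//.
  by apply: measurableC; exact: measurable_itv.
by apply/disjoints_subset.
Qed.

Lemma measure_adic_words n (Q : {pred n.-tuple 'I_l}) :
  mu (\bigcup_(w in [set` Q]) adic_itv R w) = (\sum_(w in Q) mu (adic_itv R w))%E.
Proof.
rewrite measure_fin_bigcup//.
- by rewrite [RHS]bigfs// ?index_enum_uniq// => w _; rewrite mem_index_enum.
- exact: sub_trivIset (trivIset_adic_itv l0 n).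
- by move=> w _; exact: measurable_adic_itv.
Qed.

(** The part of [B] outside the unit interval lies in no adic interval, but it is null. *)
Lemma measure_le_adic_words n (Q : {pred n.-tuple 'I_l}) (B : set (measurableTypeR R)) :
  measurable B -> (forall w x, B x -> adic_itv R w x -> w \in Q) ->
  (mu B <= \sum_(w in Q) mu (adic_itv R w))%E.
Proof.
move=> mB BQ; rewrite -measure_adic_words.
set V := \bigcup_(w in _) _.
have mV : measurable (V : set (measurableTypeR R)).
  by apply: fin_bigcup_measurable => // w _; exact: measurable_adic_itv.
have mB' : measurable (B `\` `[0%R, 1%R[%classic : set (measurableTypeR R)).
  by apply: measurableD => //; exact: measurable_itv.
apply: (@le_trans _ _ (mu ((B `\` `[0%R, 1%R[%classic) `|` V))).
  apply: le_measure; rewrite ?inE//; first exact: measurableU.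
  move=> x Bx; have [x01|x01] := pselect (x \in `[0, 1[); last by left.
  right; have [|w wx] := @adic_itv_exists R l l0 n x; first by rewrite in_itv/= in x01.
  by exists w => //=; exact: BQ wx.
apply: (le_trans (measureU2 _ _ _)) => //.
by rewrite [X in (X + _)%E]measure_outside_adic ?setDKI// add0e.
Qed.

Definition adic_positive n : {pred n.-tuple 'I_l} :=
  [pred w | (0 < mu (adic_itv R w))%E].

(** The closures of the non-null intervals of generation [n] form a finite union, hence a closed
    set, whose complement is null and so misses the support. Conversely, a neighbourhood of [x]
    contains every sufficiently short adic interval whose closure contains [x]. *)
Lemma msupp_adic x : msupp mu x <-> forall n, exists2 w : n.-tuple 'I_l,
  (0 < mu (adic_itv R w))%E & word_point R w <= x <= word_point R w + l%:R ^- n.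
Proof.
split=> [xK n|h U oU Ux].
  apply: contrapT => hn.
  pose Z := \bigcup_(w in [set` @adic_positive n])
     `[word_point R w, word_point R w + l%:R ^- n]%classic.
  have cZ : closed Z by apply: closed_bigcup => // w _; exact: itv_closed.
  have Zx : ~ Z x by move=> [w /= wp]; rewrite in_itv/= => hx; apply: hn; exists w.
  have := xK (~` Z) (closed_openC cZ) Zx; apply/negP; rewrite -leNgt.
  apply: (@le_trans _ _ (\sum_(w in [predC @adic_positive n]) mu (adic_itv R w))%E).
    apply: measure_le_adic_words.
      by apply: measurableC; exact: closed_measurable.
    move=> w y nZy wy; rewrite inE; apply/negP => wp; apply: nZy; exists w => //.
    by move: wy; rewrite /adic_itv /= !in_itv/= => /andP[-> /ltW ->].
  rewrite big1// => w; rewrite inE /= -leNgt => w0.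
  by apply/eqP; rewrite eq_le w0 measure_ge0.
have /nbhs_ballP[e /= e0 eU] : nbhs x U by exact: open_nbhs_nbhs.
have [n _ /(_ n (leqnn n)) /= ne] := near_geometric_lt R l%:R 1 e l1 e0.
rewrite mul1r in ne.
have [w wp /andP[wx xw]] := h n.
apply: (lt_le_trans wp); apply: le_measure; rewrite ?inE.
- exact: measurable_adic_itv.
- exact: open_measurable.
- move=> y; rewrite /adic_itv /= in_itv/= => /andP[wy yw]; apply: eU.
  by rewrite /ball/= ltr_distl; have := lV0 n => ?; apply/andP; split; lra.
Qed.

Lemma closed_msupp : closed (msupp mu).
Proof.
move=> x xK U oU Ux.
have [y [yK Uy]] := xK U (open_nbhs_nbhs (conj oU Ux)).
exact: yK.
Qed.

Lemma measurable_msupp : measurable (msupp mu : set (measurableTypeR R)).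
Proof. by apply: closed_measurable; exact: closed_msupp. Qed.

(** There are countably many adic intervals, so the null ones have a null union. Any point of the
    unit interval outside it has only non-null adic intervals around it. *)
Lemma adic_null_negligible : exists Z : set (measurableTypeR R),
  [/\ measurable Z, mu Z = 0%E & forall n (w : n.-tuple 'I_l) x,
    adic_itv R w x -> ~ Z x -> (0 < mu (adic_itv R w))%E].
Proof.
pose Z n := \bigcup_(w in [set` [predC @adic_positive n]]) adic_itv R w.
have Z0 n : mu (Z n) = 0%E.
  rewrite measure_adic_words big1// => w; rewrite inE /= -leNgt => w0.
  by apply/eqP; rewrite eq_le w0 measure_ge0.
have mZ n : measurable (Z n : set (measurableTypeR R)).
  by apply: fin_bigcup_measurable => // w _; exact: measurable_adic_itv.
have mUZ : measurable (\bigcup_n Z n : set (measurableTypeR R)).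
  exact: bigcup_measurable.
exists (\bigcup_n Z n); split => //.
  apply/eqP; rewrite eq_le measure_ge0 andbT.
  apply: (le_trans (measure_sigma_subadditive _ _ _ (@subset_refl _ _))) => //.
  by rewrite eseries0// => i _ _; exact: Z0.
move=> n w x wx nZ; rewrite ltNge; apply/negP => w0; apply: nZ.
by exists n => //; exists w; rewrite //= inE /= -leNgt.
Qed.

Lemma msupp_measure1 : mu (msupp mu) = 1%E.
Proof.
have mK := measurable_msupp; have [Z [mZ Z0 ZP]] := adic_null_negligible.
suff : mu (~` msupp mu) = 0%E.
  rewrite probability_setC// => /eqP; rewrite sube_eq ?add0e.
  - by move=> /eqP ->.
  - by [].
  - by rewrite fin_num_adde_defl// fin_num_measure.
apply/eqP; rewrite eq_le measure_ge0 andbT.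
have mK01 : measurable (~` msupp mu `\` `[0%R, 1%R[%classic : set (measurableTypeR R)).
  by apply: measurableD; [exact: measurableC|exact: measurable_itv].
apply: (@le_trans _ _ (mu ((~` msupp mu `\` `[0%R, 1%R[%classic) `|` Z))).
  apply: le_measure; rewrite ?inE//.
  - exact: measurableC.
  - exact: measurableU.
  - move=> x nKx; have [x01|x01] := pselect (x \in `[0, 1[); last by left.
    right; apply: contrapT => nZ; apply: nKx; apply/msupp_adic => n.
    have [|w wx] := @adic_itv_exists R l l0 n x; first by rewrite in_itv/= in x01.
    exists w; first exact: ZP wx nZ.
    by move: wx; rewrite /adic_itv /= in_itv/= => /andP[-> /ltW ->].
apply: (le_trans (measureU2 _ _ _)) => //.
by rewrite [X in (X + _)%E]measure_outside_adic ?setDKI// add0e [leLHS]Z0.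
Qed.

End adic_support.

(* [mu] is the Caratheodory extension of its own distribution function. *)
Lemma outer_regular_cover (R : realType) (mu : probability (measurableTypeR R) R)
    (A : set (measurableTypeR R)) (e : R) : measurable A -> 0 < e ->
  exists J : nat -> set (measurableTypeR R), [/\ forall k, ocitv (J k),
    A `<=` \bigcup_k J k & (\sum_(k <oo) mu (J k) <= mu A + e%:E)%E].
Proof.
move=> mA e0; have := @lebesgue_stieltjes_cdf_id R mu.
set F := (X in lebesgue_stieltjes_measure X) => FE.
have /(lb_ereal_inf_adherent e0) [_ [J [mJ AJ] <-] /ltW Je] :
    mu_ext (wlength F) A \is a fin_num.
  by rewrite -[mu_ext _ _]/(lebesgue_stieltjes_measure F A) FE// fin_num_measure.
exists J; split => //.
rewrite -(FE A mA); apply: le_trans Je; apply: lee_nneseries => // k _.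
rewrite -(FE (J k)); last by apply: sub_sigma_algebra; exact: mJ.
rewrite /lebesgue_stieltjes_measure /measure_extension.
by rewrite (@measurable_mu_extE _ _ _ (wlength F) (J k) (mJ k)).
Qed.

(** * Growth of balls, counting, and the upper bound on Hausdorff measure *)

Section adic_regular_measures.
Context {R : realType} {l : nat} (lam C : R).
Variable mu : probability (measurableTypeR R) R.
Hypothesis l2 : (2 <= l)%N.
Hypothesis reg : adic_regular R l lam C mu.

Let mu01 : mu `[0%R, 1%R[%classic = 1%E. Proof. by case: reg. Qed.
Let lam1 : 1 < lam. Proof. by case: reg. Qed.
Let C1 : 1 <= C. Proof. by case: reg. Qed.
Let mu_ub n (w : n.-tuple 'I_l) : (mu (adic_itv R w) <= (C * lam ^- n)%:E)%E.
Proof. by case: reg. Qed.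
Let mu_lb n (w : n.-tuple 'I_l) : (0 < mu (adic_itv R w))%E ->
  ((C^-1 * lam ^- n)%:E <= mu (adic_itv R w))%E.
Proof. by case: reg => _ _ _ _; apply. Qed.

Let l1 : 1 < l%:R :> R. Proof. by rewrite ltr1n. Qed.
Let lR0 : 0 < l%:R :> R. Proof. exact: lt_trans l1. Qed.
Let lX0 n : 0 < l%:R ^+ n :> R. Proof. by rewrite exprn_gt0. Qed.
Let lV0 n : 0 < l%:R ^- n :> R. Proof. by rewrite invr_gt0. Qed.
Let lam0 : 0 < lam. Proof. exact: lt_trans lam1. Qed.
Let lamV0 n : 0 < lam ^- n. Proof. by rewrite invr_gt0 exprn_gt0. Qed.
Let C0 : 0 < C. Proof. exact: lt_le_trans C1. Qed.

Let s := ln lam / ln l%:R.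
Let s0 : 0 < s. Proof. by rewrite divr_gt0// ln_gt0. Qed.
Let powVs n : (l%:R ^- n) `^ s = lam ^- n. Proof. exact: powR_adic. Qed.

(** The index is an integer because the cells covering an arbitrary interval may lie outside [[0,
    1[], where they are null. *)
Let mu_cell n (k : int) :
  (mu `[(k%:~R / l%:R ^+ n)%R, ((k + 1)%:~R / l%:R ^+ n)%R[%classic
     <= (C * lam ^- n)%:E)%E.
Proof.
have [/andP[k0 kl]|kout] := boolP ((0 <= k) && (k < (l ^ n)%:Z)).
  case: k k0 kl => // k _; rewrite ltz_nat => kl.
  have [w wk] := @word_nat_onto l n k kl.
  by rewrite intrD -pmulrn natr1 -wk -adic_itvE.
rewrite (measure_outside_adic _ mu01).
- by rewrite lee_fin mulr_ge0// ltW.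
- exact: measurable_itv.
rewrite -subset0 => x /= [/=]; rewrite !in_itv/= => /andP[a b] /andP[c d].
case/negP : kout; apply/andP; split.
- rewrite -ltzD1 -(ltr_int R) -(pmulr_lgt0 _ (lV0 n)).
  exact: le_lt_trans b.
- rewrite -(ltr_int R); move: a; rewrite ler_pdivrMr// => /le_lt_trans; apply.
  by rewrite -pmulrn natrX -[ltRHS]mul1r ltr_pM2r.
Qed.

Let mu_short n a b : b - a < l%:R ^- n ->
  (mu `[a, b]%classic <= (2 * (C * lam ^- n))%:E)%E.
Proof.
move=> ab; pose k := Num.floor (a * l%:R ^+ n).
pose cell (k : int) : set (measurableTypeR R) :=
  `[(k%:~R / l%:R ^+ n)%R, ((k + 1)%:~R / l%:R ^+ n)%R[%classic.
have mcell j : measurable (cell j) by exact: measurable_itv.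
have sub : `[a, b]%classic `<=` cell k `|` cell (k + 1).
  have /andP[k1 k2] := floor_itv (a * l%:R ^+ n).
  move=> x /=; rewrite /cell /= !in_itv/= => /andP[ax xb].
  have h1 : k%:~R / l%:R ^+ n <= x by rewrite (le_trans _ ax)// ler_pdivrMr.
  have [h2|h2] := ltP x ((k + 1)%:~R / l%:R ^+ n); first by left; rewrite h1.
  right; apply/andP; split => //; apply: (le_lt_trans xb).
  rewrite -ltr_pdivlMr// in k2; rewrite intrD mulrDl mul1r.
  by rewrite -ltrBlDl; apply: lt_trans ab; rewrite ltrD2l ltrN2.
apply: (@le_trans _ _ (mu (cell k `|` cell (k + 1)))).
  by apply: le_measure; rewrite ?inE//; exact: measurableU.
apply: (le_trans (measureU2 _ _ _)) => //.
by rewrite mulr_natl mulr2n EFinD leeD// mu_cell.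
Qed.

Let mu_set1 x : mu [set x] = 0%E.
Proof.
apply/eqP; rewrite eq_le measure_ge0 andbT; apply/lee_addgt0Pr => e e0.
rewrite add0e.
have [n _ /(_ n (leqnn n))] := near_geometric_lt R lam (2 * C) e lam1 e0.
move=> /= h; rewrite -set_itv1 (le_trans (mu_short n x x _)) ?subrr//.
by rewrite lee_fin mulrA ltW.
Qed.

(** The first 2 counts the cells met by an interval shorter than a cell, [lam] pays for rounding the
    length [2 * d] to an adic scale, and the last factor turns the power of [2 * d] into that of
    [d]. *)
Definition adic_growth_const := 2 * C * lam * 2 `^ s.
Let M := adic_growth_const.

Lemma adic_growth_const_gt0 : 0 < M.
Proof. by rewrite !mulr_gt0// powR_gt0. Qed.

Lemma adic_growth x d : 0 <= d ->
  (mu `[(x - d)%R, (x + d)%R]%classic <= (M * d `^ s)%:E)%E.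
Proof.
move=> d0; have mI : measurable (`[(x - d)%R, (x + d)%R]%classic : set (measurableTypeR R)).
  exact: measurable_itv.
have [->|dn0] := eqVneq d 0.
  by rewrite subr0 addr0 set_itv1 mu_set1 powR0 ?mulr0// lt0r_neq0.
have {dn0} d0' : 0 < d by rewrite lt_neqAle eq_sym dn0.
have -> : M * d `^ s = 2 * C * lam * (2 * d) `^ s.
  by rewrite powRM// /M /adic_growth_const; ring.
have [d1|d1] := leP 1 (2 * d).
  apply: (@le_trans _ _ 1%E); first exact: probability_le1.
  rewrite lee_fin.
  have h : 1 <= (2 * d) `^ s.
    apply: (@le_trans _ _ (1 `^ s)); first by rewrite powR1.
    by apply: ge0_ler_powR; rewrite ?nnegrE ?(ltW s0) ?(le_trans _ d1).
  apply: (le_trans h); rewrite ler_peMl ?powR_ge0//.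
  by rewrite -mulrA mulr_ege1// ?ler1n// mulr_ege1// ltW.
have [n /andP[n1 n2]] : exists n, l%:R ^- n.+1 <= 2 * d < l%:R ^- n.
  by apply: adic_scale => //; rewrite d1 mulr_gt0.
apply: (le_trans (mu_short n _ _ _)); first by apply: le_lt_trans n2; lra.
rewrite lee_fin -!mulrA !ler_pM2l//.
apply: (@le_trans _ _ (lam * lam ^- n.+1)).
  by rewrite exprS invfM mulrA mulfV ?mul1r// gt_eqF.
rewrite ler_pM2l// -powVs ge0_ler_powR ?nnegrE// ?ltW// mulr_gt0//.
Qed.

Let K := msupp mu.
Let pos n := @adic_positive R l mu n.

Lemma sum_adic_positive n : (\sum_(w in pos n) mu (adic_itv R w) = 1)%E.
Proof.
apply/eqP; rewrite eq_le; apply/andP; split.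
  rewrite -(measure_adic_words mu l2); apply: probability_le1.
  by apply: fin_bigcup_measurable => // w _; exact: measurable_adic_itv.
have := @measure_le_adic_words R l mu l2 mu01 n predT `[0%R, 1%R[%classic.
rewrite mu01 (bigID (mem (pos n)))/= [X in (_ + X)%E]big1 ?adde0; first by apply.
move=> w; rewrite inE /= -leNgt => w0.
by apply/eqP; rewrite eq_le w0 measure_ge0.
Qed.

Lemma card_adic_positive_le n : #|pos n|%:R <= C * lam ^+ n.
Proof.
have : ((\sum_(w in pos n) (C^-1 * lam ^- n))%:E <= 1)%E.
  by rewrite -(sum_adic_positive n) -sumEFin; apply: lee_sum => w; exact: mu_lb.
rewrite lee_fin sumr_const -[_ *+ _]mulr_natl -invfM.
by rewrite ler_pdivrMr ?mul1r ?mulr_gt0 ?exprn_gt0.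
Qed.

Lemma card_adic_positive_ge n : C^-1 * lam ^+ n <= #|pos n|%:R.
Proof.
have : (1 <= (\sum_(w in pos n) (C * lam ^- n))%:E)%E.
  by rewrite -[leLHS](sum_adic_positive n) -sumEFin; apply: lee_sum => w _; exact: mu_ub.
rewrite lee_fin sumr_const -[_ *+ _]mulr_natl mulrA ler_pdivlMr ?exprn_gt0// mul1r.
by rewrite -ler_pdivrMr// mulrC.
Qed.

Lemma diam_adic_closure n (w : n.-tuple 'I_l) :
  (diam `[word_point R w, (word_point R w + l%:R ^- n)%R]%classic <= (l%:R ^- n)%:E)%E.
Proof.
apply: diam_le => x y /=; rewrite !in_itv/= => /andP[x1 x2] /andP[y1 y2].
by rewrite ler_distl; apply/andP; split; lra.
Qed.

Lemma msupp_adic_cover n : K `<=` \bigcup_(w in [set w | w \in pos n])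
  `[word_point R w, word_point R w + l%:R ^- n]%classic.
Proof.
by move=> x /(msupp_adic mu l2 mu01) /(_ n) [w wp wx]; exists w => //=; rewrite in_itv.
Qed.

(* The adic intervals of generation [n] used to cover [`]a, b] `&` K] stick out of
   [`]a, b]] only near [a] and [b], where [adic_growth] bounds the excess mass. *)
Lemma adic_hausdorff_ocitv delta (J : set (measurableTypeR R)) : 0 < delta -> ocitv J ->
  (hausdorff_premeasure s delta (J `&` K) <= C%:E * mu J)%E.
Proof.
move=> d0 /ocitvP [->|[[a b] /= ab ->]].
  rewrite set0I measure0 mule0.
  have := @hausdorff_premeasure_le_sum R s delta set0 void pred0 (fun=> set0).
  by rewrite big_pred0//; apply => // i; rewrite diam_set0 leNye.
have M0 := adic_growth_const_gt0; rewrite -/M in M0.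
apply/lee_addgt0Pr => e e0.
near \oo => n.
have ld : l%:R ^- n <= delta.
  by rewrite -[leLHS]mul1r; apply/ltW; near: n; exact: near_geometric_lt.
(* One [M] for each endpoint of [J]; the factor [C] comes from comparing gauges with masses. *)
have Me : C * (M + M) * lam ^- n <= e by apply/ltW; near: n; exact: near_geometric_lt.
pose cl (w : n.-tuple 'I_l) := `[word_point R w, (word_point R w + l%:R ^- n)%R]%classic.
pose I0 : set R := `]a, b]%classic.
pose Q := [pred w | (w \in pos n) && asbool (cl w `&` I0 !=set0)].
have diamcl w : (diam (cl w) <= (l%:R ^- n)%:E)%E by exact: diam_adic_closure.
apply: (@le_trans _ _ (\sum_(w in Q) gauge s (cl w))%E).
  apply: hausdorff_premeasure_le_sum => [w|x [xJ xK]].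
    by apply: (le_trans (diamcl w)); rewrite lee_fin.
  have [w /= wp wx] := msupp_adic_cover n x xK.
  by exists w => //=; rewrite inE/= wp; apply/asboolP; exists x.
apply: (@le_trans _ _ (\sum_(w in Q) C%:E * mu (adic_itv R w))%E).
  apply: lee_sum => w /andP[wp _].
  apply: (le_trans (gauge_le s _ _ (ltW s0) (ltW (lV0 n)) (diamcl w))).
  rewrite powVs -lee_pdivrMl// -EFinM; exact: mu_lb.
rewrite -ge0_sume_distrr// -(measure_adic_words mu l2).
rewrite -lee_pdivlMl// muleDr ?fin_num_adde_defl// muleA -EFinM mulVf ?gt_eqF// mul1e.
pose h := l%:R ^- n : R.
apply: (@le_trans _ _ (mu (`]a, b]%classic `|`
    (`[a - h, a + h]%classic `|` `[b - h, b + h]%classic)))).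
  apply: le_measure; rewrite ?inE//.
  - by apply: fin_bigcup_measurable => // w _; exact: measurable_adic_itv.
  - by apply: measurableU => //; exact: measurableU.
  move=> y [w /= /andP[_ /asboolP [z []]]].
  rewrite /cl /adic_itv /= !in_itv/= => /andP[z1 z2] /andP[z3 z4] /andP[y1 y2].
  have h0 := lV0 n; rewrite !bnd_simp in z3 z4.
  have [ya|ya] := leP y a; first by right; left; apply/andP; split; rewrite /h; lra.
  have [yb|yb] := leP y b; first by left.
  by right; right; apply/andP; split; rewrite /h; lra.
apply: (le_trans (measureU2 _ _ _)) => //; first exact: measurableU.
rewrite leeD2l//; apply: (le_trans (measureU2 _ _ _)) => //.
apply: (le_trans (leeD (adic_growth a h (ltW (lV0 n))) (adic_growth b h (ltW (lV0 n))))).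
rewrite -EFinD -EFinM lee_fin powVs -mulrDl ler_pdivlMl//.
by rewrite mulrA.
Unshelve. all: by end_near. Qed.

Lemma adic_hausdorff_le (A : set (measurableTypeR R)) : measurable A ->
  (hausdorff_measure s (A `&` K) <= C%:E * mu A)%E.
Proof.
move=> mA; apply: hausdorff_measure_le => delta d0.
apply/lee_addgt0Pr => e e0.
have e0' : 0 < C^-1 * e by rewrite mulr_gt0 ?invr_gt0.
have [J [oJ AJ Je]] := outer_regular_cover R mu A (C^-1 * e) mA e0'.
apply: (@le_trans _ _ (hausdorff_premeasure s delta (\bigcup_k (J k `&` K)))).
  by apply: le_hausdorff_premeasure; rewrite -setI_bigcupl; exact: setSI.
apply: (le_trans (hausdorff_premeasure_bigcup _ _ _)).
apply: (@le_trans _ _ (\sum_(k <oo) C%:E * mu (J k))%E).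
  apply: lee_nneseries => k *; first exact: hausdorff_premeasure_ge0.
  exact: adic_hausdorff_ocitv.
rewrite nneseriesZl//.
apply: (@le_trans _ _ (C%:E * (mu A + (C^-1 * e)%:E))%E); first by rewrite lee_pmul2l.
by rewrite muleDr ?fin_num_adde_defl// -EFinM mulrA mulfV ?mul1r// gt_eqF.
Qed.

End adic_regular_measures.

(** Taking logarithms, the ratio differs from [s] by at most [ln c] over [g t] in absolute value.
    The sign of [g] is left free: it is [n%:R * ln l%:R] for the structure function, its opposite
    for local dimensions, and [- ln delta] for the box dimension. *)
Lemma lne_ratio_cvg (R : realType) (T : Type) (F : set_system T)
    (FF : Filter F) (f : T -> \bar R) (g : T -> R) (c s : R) : 0 < c ->
  (\forall t \near F,
    ((c^-1 * expR (s * g t))%:E <= f t <= (c * expR (s * g t))%:E)%E) ->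
  (\forall t \near F, g t != 0) -> (g t)^-1 @[t --> F] --> 0 ->
  (lne (f t) / (g t)%:E)%E @[t --> F] --> s%:E.
Proof.
move=> c0 hf g0 gV.
pose h t := fine (lne (f t)) / g t.
have hE : \forall t \near F, (lne (f t) / (g t)%:E)%E = (h t)%:E /\
    `|s - h t| <= `|ln c| * `|(g t)^-1|.
  near=> t.
  have gt0 : g t != 0 by near: t.
  have : ((c^-1 * expR (s * g t))%:E <= f t <= (c * expR (s * g t))%:E)%E by near: t.
  have c1 : 0 < c^-1 * expR (s * g t) by rewrite mulr_gt0 ?invr_gt0 ?expR_gt0.
  rewrite /h; case: (f t) => [r| |] //; last by rewrite leye_eq/= andbF.
  rewrite !lee_fin => /andP[r1 r2].
  have r0 : 0 < r by exact: lt_le_trans r1.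
  rewrite lne_EFin//= inver (negbTE gt0); split => //.
  have -> : s - ln r / g t = (s * g t - ln r) * (g t)^-1 by rewrite mulrBl mulfK.
  rewrite normrM ler_wpM2r//.
  have h1 : - ln c + s * g t <= ln r.
    by rewrite -lnV// -[X in _ + X](expRK) -lnM ?posrE ?invr_gt0 ?expR_gt0// ler_ln.
  have h2 : ln r <= ln c + s * g t.
    rewrite -[X in _ + X](expRK) -lnM ?posrE ?expR_gt0//.
    by rewrite ler_ln// posrE mulr_gt0// expR_gt0.
  apply: (@le_trans _ _ (ln c)); last exact: ler_norm.
  by rewrite ler_norml; apply/andP; split; lra.
apply: (@cvg_trans _ ((h t)%:E @[t --> F])).
  by apply: near_eq_cvg; apply: filterS hE => t [].
apply/cvg_EFin; first by near=> t.
apply/cvgrPdist_le => e e0.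
have e1 : 0 < e / (`|ln c| + 1) by rewrite divr_gt0// ltr_wpDl.
move: gV => /cvgr0_norm_le /(_ _ e1).
apply: filterS2 hE => t [_ ht] gt; apply: (le_trans ht).
apply: (@le_trans _ _ ((`|ln c| + 1) * (e / (`|ln c| + 1)))).
  by rewrite ler_pM// lerDl.
by rewrite mulrC divfK// gt_eqF// ltr_wpDl.
Unshelve. all: by end_near. Qed.

(** * Equivalence with Hausdorff measure, dimensions and level sets *)

Section adic_regular_dimensions.
Context {R : realType} {l : nat} (lam C : R).
Variable mu : probability (measurableTypeR R) R.
Hypothesis l2 : (2 <= l)%N.
Hypothesis reg : adic_regular R l lam C mu.

Let mu01 : mu `[0%R, 1%R[%classic = 1%E. Proof. by case: reg. Qed.
Let lam1 : 1 < lam. Proof. by case: reg. Qed.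
Let C1 : 1 <= C. Proof. by case: reg. Qed.
Let l0 : (0 < l)%N. Proof. exact: leq_trans l2. Qed.
Let l1 : 1 < l%:R :> R. Proof. by rewrite ltr1n. Qed.
Let lR0 : 0 < l%:R :> R. Proof. exact: lt_trans l1. Qed.
Let lX0 n : 0 < l%:R ^+ n :> R. Proof. by rewrite exprn_gt0. Qed.
Let lV0 n : 0 < l%:R ^- n :> R. Proof. by rewrite invr_gt0. Qed.
Let lam0 : 0 < lam. Proof. exact: lt_trans lam1. Qed.
Let C0 : 0 < C. Proof. exact: lt_le_trans C1. Qed.
Let lnl0 : 0 < ln (l%:R : R). Proof. exact: ln_gt0. Qed.

Let s := ln lam / ln l%:R.
Let s0 : 0 < s. Proof. by rewrite divr_gt0// ln_gt0. Qed.
Let powVs n : (l%:R ^- n) `^ s = lam ^- n. Proof. exact: powR_adic. Qed.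
Let M := @adic_growth_const R l lam C.
Let M0 : 0 < M. Proof. exact: (adic_growth_const_gt0 _ _ mu). Qed.
Let growth x d : 0 <= d ->
  (mu `[(x - d)%R, (x + d)%R]%classic <= (M * d `^ s)%:E)%E.
Proof. exact: adic_growth. Qed.

Let K := msupp mu.
Let mK : measurable (K : set (measurableTypeR R)). Proof. exact: measurable_msupp. Qed.
Let muK : mu K = 1%E. Proof. exact: (@msupp_measure1 R l). Qed.

Let muIK (A : set (measurableTypeR R)) : measurable A -> mu (A `&` K) = mu A.
Proof.
move=> mA; apply/eqP; rewrite eq_le; apply/andP; split.
  by apply: le_measure; rewrite ?inE//; exact: measurableI.
have mAK : measurable (A `&` K) by exact: measurableI.
have mKC : measurable (~` K : set (measurableTypeR R)) by exact: measurableC.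
apply: (@le_trans _ _ (mu ((A `&` K) `|` ~` K))).
  apply: le_measure; rewrite ?inE//; first exact: measurableU.
  by move=> x Ax; have [Kx|Kx] := pselect (K x); [left|right].
apply: (le_trans (measureU2 _ _ _)) => //.
by rewrite [X in (_ + X)%E]probability_setC// muK subee// adde0.
Qed.

Lemma adic_strongly_equivalent :
  strongly_equivalent mu (fun A => hausdorff_measure s (A `&` K)).
Proof.
(* [C] serves one inequality and [M] the other; the sum serves both. *)
exists (C + M); first by rewrite addr_gt0.
move=> A mA; have mAK : measurable (A `&` K) by exact: measurableI.
split.
  rewrite lee_pdivrMl ?addr_gt0//; apply: (le_trans (adic_hausdorff_le _ _ _ l2 reg _ mA)).
  by rewrite lee_wpmul2r// lee_fin lerDl ltW.
rewrite -muIK//; apply: (@le_trans _ _ (M%:E * hausdorff_measure s (A `&` K))%E).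
  by apply: (mass_distribution _ s _ M0 s0 growth) => //; rewrite lexx ltW.
by rewrite lee_wpmul2r ?hausdorff_measure_ge0// lee_fin lerDr ltW.
Qed.

(** At most [C * lam ^+ n] closures of generation [n] cover [K], at total cost [C * q ^- n], where
    [q > 1] because [t] exceeds [s]. *)
Let hausdorff_measure_gt t : s < t -> hausdorff_measure t K = 0%E.
Proof.
move=> st; apply/eqP; rewrite eq_le hausdorff_measure_ge0 andbT.
have t0 : 0 <= t by apply/ltW/(lt_trans s0).
apply: hausdorff_measure_le => delta d0; apply/lee_addgt0Pr => e e0; rewrite add0e.
pose q := l%:R `^ t / lam.
have lt0 : 0 < l%:R `^ t by rewrite powR_gt0.
have q1 : 1 < q.
  by rewrite ltr_pdivlMr// mul1r -ltr_ln ?posrE// ln_powR -ltr_pdivrMr.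
near \oo => n.
have ld : l%:R ^- n <= delta.
  by rewrite -[leLHS]mul1r; apply/ltW; near: n; exact: near_geometric_lt.
have qe : C * q ^- n <= e by apply/ltW; near: n; exact: near_geometric_lt.
apply: (@le_trans _ _ (\sum_(w in @adic_positive R l mu n)
    gauge t `[word_point R w, (word_point R w + l%:R ^- n)%R]%classic)%E).
  apply: hausdorff_premeasure_le_sum; last exact: (@msupp_adic_cover R l lam C).
  by move=> w; apply: (le_trans (diam_adic_closure n w)); rewrite lee_fin.
apply: (@le_trans _ _ (\sum_(w in @adic_positive R l mu n) ((l%:R ^- n) `^ t)%:E)%E).
  by apply: lee_sum => w _; apply: gauge_le => //; exact: diam_adic_closure.
rewrite sumEFin lee_fin sumr_const -[_ *+ _]mulr_natl; apply: le_trans qe.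
have -> : (l%:R ^- n) `^ t = (l%:R `^ t) ^- n.
  by rewrite -(powR_adic l l2 _ n lt0) ln_powR mulfK// gt_eqF.
rewrite /q expr_div_n invf_div mulrA ler_pM2r ?invr_gt0 ?exprn_gt0//.
exact: (card_adic_positive_le _ _ mu l2 reg).
Unshelve. all: by end_near. Qed.

Lemma adic_hausdorff_dim : hausdorff_dim K = s%:E.
Proof.
apply/eqP; rewrite eq_le; apply/andP; split.
  apply/lee_addgt0Pr => e e0; apply: ereal_inf_lbound; exists (s + e) => //.
  by split; [rewrite addr_ge0// ltW|rewrite hausdorff_measure_gt// ltrDl].
by apply: (hausdorff_dim_ge _ s _ M0 s0 growth) => //; rewrite [ltRHS]muK.
Qed.

Lemma adic_has_dim : has_dim mu s%:E.
Proof.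
split; apply/eqP; rewrite eq_le; apply/andP; split.
- rewrite -adic_hausdorff_dim; apply: ereal_inf_lbound; exists K => //.
  by split => //; rewrite [ltRHS]muK.
- apply: le_ereal_inf_tmp => _ [E [mE muE] <-].
  exact: (hausdorff_dim_ge _ s _ M0 s0 growth).
- by rewrite -adic_hausdorff_dim; apply: ereal_inf_lbound; exists K.
- apply: le_ereal_inf_tmp => _ [E [mE muE] <-].
  by apply: (hausdorff_dim_ge _ s _ M0 s0 growth) => //; rewrite [ltRHS]muE.
Qed.

Let expR_adic n : expR (s * (n%:R * ln l%:R)) = lam ^+ n.
Proof.
by rewrite mulrCA /s divfK ?gt_eqF// mulrC expRM_natr lnK.
Qed.

(** A cover by [n] sets of diameter at most [delta <= 1] is admissible at scale 1, so mass
    distribution bounds the total mass 1 by [M] times its cost. *)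
Lemma covering_number_ge delta : 0 < delta <= 1 ->
  ((M^-1 * delta `^ (- s))%:E <= covering_number K delta)%E.
Proof.
move=> /andP[d0 d1]; apply: le_ereal_inf_tmp => _ [n [U [Ud KU]] <-].
have KU1 : (hausdorff_premeasure s 1 K <= (n%:R * delta `^ s)%:E)%E.
  apply: (@le_trans _ _ (\sum_(i < n) gauge s (U i))%E).
    apply: hausdorff_premeasure_le_sum => [i|x /KU[i _ Ux]]; last by exists i.
    by apply: (le_trans (Ud i)); rewrite lee_fin.
  apply: (@le_trans _ _ (\sum_(i < n) (delta `^ s)%:E)%E).
    by apply: lee_sum => i _; apply: gauge_le => //; exact: ltW.
  by rewrite sumEFin sumr_const card_ord -[_ *+ _]mulr_natl.
have : (1 <= (M * (n%:R * delta `^ s))%:E)%E.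
  rewrite -muK.
  apply: (le_trans (mass_distribution_premeasure _ s _ M0 s0 growth s _ _ mK)).
    by rewrite lexx ltW.
  by rewrite [leRHS]EFinM lee_pmul2l.
rewrite !lee_fin => h; rewrite powRN ler_pdivrMl// -[(_ `^ s)^-1]mul1r.
by rewrite ler_pdivrMr ?powR_gt0// -mulrA.
Qed.

Lemma covering_number_le delta : 0 < delta < 1 ->
  (covering_number K delta <= (C * lam * delta `^ (- s))%:E)%E.
Proof.
move=> d01; have [n /andP[n1 n2]] := adic_scale l l2 delta d01.
case/andP: d01 => d0 d1.
(* The intervals of generation [n.+1] have length at most [delta]; passing from [n] to [n.+1] costs
   the factor [lam]. *)
apply: (@le_trans _ _ (#|@adic_positive R l mu n.+1|%:R)%:E).
  apply: ereal_inf_lbound; exists #|@adic_positive R l mu n.+1| => //.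
  exists (fun i =>
    `[word_point R (enum_val i), word_point R (enum_val i) + l%:R ^- n.+1]%classic).
  split => [i|x Kx]; first by apply: (le_trans (diam_adic_closure _ _)); rewrite lee_fin.
  have [w /= wp wx] := msupp_adic_cover _ _ mu l2 reg n.+1 x Kx.
  by exists (enum_rank_in wp w) => //; rewrite enum_rankK_in.
rewrite lee_fin; apply: (le_trans (card_adic_positive_le _ _ mu l2 reg _)).
rewrite exprS mulrA ler_pM2l ?mulr_gt0// powRN.
rewrite -[leLHS]invrK lef_pV2 ?posrE ?invr_gt0 ?exprn_gt0 ?powR_gt0//.
by rewrite -powVs ge0_ler_powR ?nnegrE// ltW.
Qed.

Lemma adic_has_box_dim : has_box_dim K s%:E.
Proof.
rewrite /has_box_dim; apply: (@lne_ratio_cvg _ _ _ _ _ _ (C * lam + M)).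
- by rewrite addr_gt0// mulr_gt0.
- near=> delta.
  have d0 : 0 < delta by near: delta; exact: nbhs_right_gt.
  have d1 : delta < 1 by near: delta; exact: nbhs_right_lt.
  have -> : expR (s * - ln delta) = delta `^ (- s).
    by rewrite /powR gt_eqF// mulrN mulNr.
  apply/andP; split.
    apply: le_trans (covering_number_ge delta _); last by rewrite d0 ltW.
    rewrite lee_fin ler_wpM2r ?powR_ge0// lef_pV2 ?posrE ?addr_gt0 ?mulr_gt0//.
    by rewrite lerDr mulr_ge0// ltW.
  apply: (le_trans (covering_number_le delta _)); first by rewrite d0.
  by rewrite lee_fin ler_wpM2r ?powR_ge0// lerDl ltW.
- near=> delta; rewrite oppr_eq0 lt_eqF// ln_lt0//; apply/andP; split.
    by near: delta; exact: nbhs_right_gt.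
  by near: delta; exact: nbhs_right_lt.
- apply/cvgrPdist_le => e e0; near=> delta.
  have d0 : 0 < delta by near: delta; exact: nbhs_right_gt.
  have de : delta < expR (- e^-1) by near: delta; apply: nbhs_right_lt; exact: expR_gt0.
  have h : e^-1 <= - ln delta.
    by rewrite lerNr -(expRK (- e^-1)) ler_ln ?posrE ?expR_gt0// ltW.
  have h0 : 0 < - ln delta by apply: lt_le_trans h; rewrite invr_gt0.
  rewrite sub0r normrN ger0_norm ?invr_ge0 ?(ltW h0)//.
  by rewrite -[leRHS]invrK lef_pV2 ?posrE ?invr_gt0.
Unshelve. all: by end_near. Qed.

Let cvg_nlnV : ((n%:R * ln l%:R : R)^-1 @[n --> \oo] --> 0).
Proof.
suff : (n%:R^-1 * (ln l%:R)^-1 : R) @[n --> \oo] --> (0 * (ln l%:R)^-1 : R).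
  by rewrite mul0r; under [in X in X -> _]eq_fun do rewrite -invfM.
apply: cvgM; last exact: cvg_cst.
apply/gtr0_cvgV0; last exact: cvgr_idn.
by near=> n; rewrite ltr0n; near: n; exact: nbhs_infty_gt.
Unshelve. all: by end_near. Qed.

(** With the convention that 0 to the power 0 is 0, the sum at [q = 0] counts non-null intervals. So
    [m] need not be regular itself: sharing the null intervals of [mu] is enough. *)
Lemma adic_structure_fun (m : set R -> \bar R) :
  (forall n (w : n.-tuple 'I_l),
    (m (adic_itv R w) == 0%E) = (mu (adic_itv R w) == 0%E)) ->
  structure_fun l m 0 = s%:E.
Proof.
move=> mmu; rewrite /structure_fun.
under eq_fun => n.
  have -> : (\sum_(w : n.-tuple 'I_l) pow_conv (m (adic_itv R w)) 0 =
      #|@adic_positive R l mu n|%:R%:E)%E.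
    rewrite -sum1_card natr_sum -sumEFin big_mkcond/= [RHS]big_mkcond/=.
    apply: eq_bigr => w _.
    rewrite /pow_conv mmu inE/= lt0e measure_ge0 andbT.
    by case: eqP => //= _; rewrite poweRe0.
  over.
suff /cvg_limn_einf_sup[_ ->] : (lne (#|@adic_positive R l mu n|%:R)%:E
   / (n%:R * ln l%:R)%:E)%E @[n --> \oo] --> s%:E by [].
apply: (@lne_ratio_cvg _ _ _ _ _ _ C) => //.
- near=> n; rewrite expR_adic !lee_fin; apply/andP; split.
    exact: (card_adic_positive_ge _ _ mu l2 reg).
  exact: (card_adic_positive_le _ _ mu l2 reg).
- near=> n; rewrite mulf_neq0 ?gt_eqF// ltr0n.
  by near: n; exact: nbhs_infty_gt.
Unshelve. all: by end_near. Qed.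

Let lebesgue_adic n (w : n.-tuple 'I_l) :
  @lebesgue_measure R (adic_itv R w) = (l%:R ^- n)%:E.
Proof.
by rewrite /adic_itv lebesgue_measure_itv/= lte_fin ltrDl lV0 -EFinB addrAC subrr add0r.
Qed.

Let level_set_positive x : 0 <= x < 1 ->
  (\forall n \near \oo, 0 < mu (adic_itv_at l n x))%E ->
  (lne (mu (adic_itv_at l n x)) / lne (@lebesgue_measure R (adic_itv_at l n x)))%E
    @[n --> \oo] --> s%:E.
Proof.
move=> x01 xp.
have atE n : exists w : n.-tuple 'I_l, adic_itv_at l n x = adic_itv R w.
  by have [w wx] := adic_itv_exists l0 n x x01; exists w; exact: adic_itv_atE.
have -> : (fun n => (lne (mu (adic_itv_at l n x)) /
    lne (@lebesgue_measure R (adic_itv_at l n x)))%E) =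
  (fun n => (lne (mu (adic_itv_at l n x)) / (- (n%:R * ln l%:R))%:E)%E).
  apply/funext => n; have [w ->] := atE n; rewrite lebesgue_adic lne_EFin//.
  by rewrite lnV ?posrE// lnXn// mulr_natl.
apply: (@lne_ratio_cvg _ _ _ _ _ _ C) => //.
- apply: filterS xp => n; rewrite mulrN expRN expR_adic; have [w ->] := atE n => wp.
  by case: reg => _ _ _ ub lb; rewrite ub lb.
- near=> n; rewrite oppr_eq0 mulf_neq0 ?gt_eqF// ltr0n.
  by near: n; exact: nbhs_infty_gt.
- under eq_fun do rewrite invrN.
  by rewrite -oppr0; apply: cvgN; exact: cvg_nlnV.
Unshelve. all: by end_near. Qed.

Lemma adic_monofractal : monofractal l mu.
Proof.
exists s; split.
  have [x [x01 xp]] : exists x : R,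
      (0 <= x < 1) /\ (forall n, (0 < mu (adic_itv_at l n x))%E).
    have [Z [mZ Z0 ZP]] := adic_null_negligible mu l2.
    have [x [x01 nZ]] : exists x : R, (x \in `[0, 1[) /\ ~ Z x.
      apply: contrapT => h; have : (mu `[0%R, 1%R[%classic <= mu Z)%E.
        apply: le_measure; rewrite ?inE//.
        by move=> x x01; apply: contrapT => nZ; apply: h; exists x.
      by rewrite mu01 Z0 leNgt lte_fin ltr01.
    rewrite in_itv/= in x01; exists x; split => // n.
    have [w wx] := adic_itv_exists l0 n x x01.
    by rewrite (adic_itv_atE l0 n w x wx); exact: ZP wx nZ.
  exists x; split => //; apply: level_set_positive => //.
  by near=> n.
move=> alpha [x [x01 xa]].
suff xp : \forall n \near \oo, (0 < mu (adic_itv_at l n x))%E.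
  have h := level_set_positive x x01 xp.
  suff : s%:E = alpha%:E by case.
  by apply: (cvg_unique _ h xa); exact: ereal_hausdorff.
(* A finite limit makes the ratios eventually finite, whereas a null interval of generation [n > 0]
   gives [-oo] over a negative number, that is [+oo]. *)
have [xfin _] := (fine_cvgP _ _).1 xa.
near=> n; rewrite lt0e measure_ge0 andbT; apply/eqP => mu0.
have : (lne (mu (adic_itv_at l n x)) /
   lne (@lebesgue_measure R (adic_itv_at l n x)))%E \is a fin_num by near: n.
have n0 : (0 < n)%N by near: n; exact: nbhs_infty_gt.
rewrite mu0 le0_lneNy//; have [w wx] := adic_itv_exists l0 n x x01.
rewrite (adic_itv_atE l0 n w x wx) lebesgue_adic lne_EFin// lnV ?posrE// lnXn//.
have h : ln (l%:R : R) *+ n > 0 by rewrite pmulrn_lgt0.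
by rewrite inver oppr_eq0 gt_eqF// mulNyr ltr0_sg ?invr_lt0 ?oppr_lt0// EFinN mulN1e.
Unshelve. all: by end_near. Qed.

End adic_regular_dimensions.

(** * Markov chains *)

Section markov_weights.
Context {R : realType} {l : nat}.
Implicit Types (p v : 'cV[R]_l) (P Q : 'M[R]_l) (s : seq 'I_l).

Lemma path_weight_ge0 P i s : (forall i j, 0 <= P i j) -> 0 <= path_weight P i s.
Proof. by move=> P0; elim: s i => //= j s IH i; rewrite mulr_ge0. Qed.

Lemma path_weight_gt0 P i s : (forall i j, 0 <= P i j) ->
  (0 < path_weight P i s) = path (fun i j => 0 < P i j) i s.
Proof.
move=> P0; elim: s i => [|j s IH] i /=; first by rewrite ltr01.
have [Pij|] := ltP 0 (P i j); first by rewrite pmulr_rgt0.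
by move=> Pij; rewrite (_ : P i j = 0) ?mul0r ?ltxx//; apply/eqP; rewrite eq_le Pij P0.
Qed.

Lemma path_weight_rcons P i s j :
  path_weight P i (rcons s j) = path_weight P i s * P (last i s) j.
Proof.
by elim: s i => [|k s IH] i /=; rewrite ?mulr1 ?mul1r// IH mulrA.
Qed.

Lemma word_weight_ge0 p P s : prob_vector p -> stochastic P ->
  0 <= word_weight p P s.
Proof.
move=> [p0 _] [P0 _]; case: s => //= i s.
by rewrite mulr_ge0// path_weight_ge0.
Qed.

Lemma word_weight_rcons p P s : prob_vector p -> stochastic P ->
  \sum_j word_weight p P (rcons s j) = word_weight p P s.
Proof.
move=> [_ p1] [_ P1]; case: s => [|i s] /=.
  by rewrite -[RHS]p1; apply: eq_bigr => j _; rewrite mulr1.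
under eq_bigr do rewrite path_weight_rcons mulrA.
by rewrite -mulr_sumr P1 mulr1.
Qed.

Lemma word_weight_gt0 p P i s : (forall i, 0 <= p i 0) -> (forall i j, 0 <= P i j) ->
  (0 < word_weight p P (i :: s)) = (0 < p i 0) && path (fun i j => 0 < P i j) i s.
Proof.
move=> p0 P0 /=; rewrite -path_weight_gt0//.
have [pi|] := ltP 0 (p i 0); first by rewrite pmulr_rgt0.
by move=> pi; rewrite (_ : p i 0 = 0) ?mul0r ?ltxx//; apply/eqP; rewrite eq_le pi p0.
Qed.

(** Otherwise [P i j] would be the whole row sum. Applied twice, it finds two positive entries in a
    row. *)
Lemma stochastic_other_gt0 P i j : stochastic P -> P i j != 1 ->
  exists2 k, k != j & 0 < P i k.
Proof.
move=> [P0 P1] Pij.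
have [[k kj Pik]|h] := pselect (exists2 k, k != j & 0 < P i k); first by exists k.
case/eqP : Pij; rewrite -(P1 i) (bigD1 j)//= big1 ?addr0// => k kj.
apply/eqP; rewrite eq_le P0 andbT leNgt; apply/negP => Pik.
by apply: h; exists k.
Qed.

Lemma driven_by_adic_gt0 p P (m : probability (measurableTypeR R) R) n
    (w : n.-tuple 'I_l) : markov_chain p P -> driven_by p P m ->
  (0 < m (adic_itv R w))%E =
  if tval w is i :: s then (0 < p i 0) && path (fun i j => 0 < P i j) i s else true.
Proof.
move=> [pp sP _] [m01 mw].
case: n w => [|n] w.
  rewrite (tuple0 w)/= /adic_itv word_pointE mul0r add0r expr0 invr1 m01.
  by rewrite lte_fin ltr01.
rewrite mw// lte_fin; case/tupleP: w => i s /=.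
by rewrite -word_weight_gt0 ?pp.1 ?sP.1//; move: pp sP => [? _] [].
Qed.

End markov_weights.

(** * The chain with transition matrix [Q0] *)

Section perron_chain.
Context {R : realType} {l : nat}.
Variables (p : 'cV[R]_l) (P : 'M[R]_l).
Hypothesis l2 : (2 <= l)%N.
Hypothesis pP : markov_chain p P.
Hypothesis irrP : irreducible_mx P.

Let P0 := zero_one_mx P.
Let pp : prob_vector p. Proof. by case: pP. Qed.
Let sP : stochastic P. Proof. by case: pP. Qed.
Let Pn1 i j : P i j != 1. Proof. by case: pP. Qed.
Let l0 : (0 < l)%N. Proof. exact: leq_trans l2. Qed.

Let P0E i j : P0 i j = (0 < P i j)%R%:R. Proof. by rewrite mxE. Qed.
Let P0_ge0 i j : 0 <= P0 i j. Proof. by rewrite P0E ler0n. Qed.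

Let P_le_P0 i j : P i j <= P0 i j.
Proof.
rewrite P0E; case: ltP => //= _; rewrite -(sP.2 i) (bigD1 j)//= lerDl.
by rewrite sumr_ge0// => k _; exact: sP.1.
Qed.

(** Entrywise [P <= P0], so the powers of [P0] dominate those of [P]. *)
Let irrP0 : irreducible_mx P0.
Proof.
move=> i j; have [n n1 Pn] := irrP i j; exists n => //.
have /andP[_] := expmx_le _ _ sP.1 P_le_P0 n i j; exact: lt_le_trans.
Qed.

Lemma zero_one_perron_vector_gt0 v : perron_vector P0 v -> forall i, 0 < v i 0.
Proof.
move=> [pv Pv]; apply: irreducible_eigenvector_gt0 Pv => //; first exact: pv.1.
exact: prob_vector_neq0.
Qed.

Lemma zero_one_perron_vector_unique : exists! v, perron_vector P0 v.
Proof.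
have [v [lam [pv Pv]]] := perron_eigenvector_exists P0 l0 P0_ge0 irrP0.
have v0 := irreducible_eigenvector_gt0 _ _ _ P0_ge0 irrP0 pv.1 (prob_vector_neq0 _ pv) Pv.
have srE := spectral_radius_eigenvector _ _ _ l0 P0_ge0 v0 Pv.
exists v; split; first by split; rewrite ?srE.
move=> w [pw Pw]; apply: irreducible_eigenvector_unique Pv _ => //.
by rewrite -srE.
Qed.

Variable v : 'cV[R]_l.
Hypothesis Pv : perron_vector P0 v.

Let lam := spectral_radius P0.
Let Q := perron_stochastic_mx P0 v.
Let q := unif_support p.

Let v0 i : 0 < v i 0. Proof. exact: zero_one_perron_vector_gt0. Qed.

Let PvE i : \sum_j P0 i j * v j 0 = lam * v i 0.
Proof. by have /colP/(_ i) := Pv.2; rewrite !mxE. Qed.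

(** At a coordinate [i] where [v] is least, row [i] of [P0] has two entries 1, so [lam * v i 0] is
    at least the sum of two coordinates of [v], hence greater than [v i 0]. *)
Let lam1 : 1 < lam.
Proof.
have [i _ vi] : exists2 i, true & forall j, v i 0 <= v j 0.
  case: (@arg_minP _ _ _ (Ordinal l0) predT (fun i => v i 0)) => // i _ h.
  by exists i => // j; exact: h.
have [k _ Pik] := stochastic_other_gt0 P i i sP (Pn1 i i).
have [k' kk' Pik'] := stochastic_other_gt0 P i k sP (Pn1 i k).
have : v i 0 < lam * v i 0.
  rewrite -PvE (bigD1 k)//= (bigD1 k')//= !P0E Pik Pik' !mul1r.
  apply: (le_lt_trans (vi k)); rewrite ltrDl ltr_pwDl//.
  by apply: sumr_ge0 => j _; rewrite mulr_ge0// ltW.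
by rewrite -{1}[v i 0]mul1r ltr_pM2r.
Qed.

Let lam0 : 0 < lam. Proof. exact: lt_trans lam1. Qed.

Let QE i j : Q i j = lam^-1 * ((v i 0)^-1 * P0 i j * v j 0).
Proof.
have uD : diag_mx v^T \in unitmx.
  by rewrite unitmxE det_diag unitfE; apply/prodf_neq0 => k _; rewrite mxE gt_eqF.
have invD : invmx (diag_mx v^T) = diag_mx (\row_k (v k 0)^-1).
  rewrite -[LHS]mulmx1; apply: (canLR (mulKmx uD)); rewrite mulmx_diag -diag_const_mx.
  by congr diag_mx; apply/rowP => k; rewrite !mxE mulfV// gt_eqF.
rewrite /Q /perron_stochastic_mx -/lam invD mxE; congr (_ * _).
by rewrite mul_mx_diag mxE mul_diag_mx !mxE.
Qed.

Let Q_ge0 i j : 0 <= Q i j.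
Proof. by rewrite QE !mulr_ge0// ?invr_ge0 ltW. Qed.

Let Q_gt0 i j : (0 < Q i j) = (0 < P i j).
Proof.
rewrite QE pmulr_rgt0 ?invr_gt0// pmulr_lgt0// pmulr_rgt0 ?invr_gt0// P0E.
by case: (0 < P i j); rewrite ?ltr01 ?ltxx.
Qed.

Let q_gt0 i : (0 < q i 0) = (0 < p i 0).
Proof.
rewrite mxE; case: ifPn => // pi; rewrite invr_gt0 ltr0n card_gt0.
by apply/set0Pn; exists i; rewrite inE.
Qed.

Let q_ge0 i : 0 <= q i 0.
Proof. by rewrite mxE; case: ifP => // _; rewrite invr_ge0. Qed.

Lemma perron_markov_chain : markov_chain q Q.
Proof.
have sQ : stochastic Q.
  split => // i; under eq_bigr do rewrite QE -mulrA.
  by rewrite -!mulr_sumr PvE mulrCA mulKf ?mulVf// gt_eqF.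
split => //.
  split => //; under eq_bigr do rewrite mxE.
  rewrite -big_mkcond/= sumr_const -[_ *+ _]mulr_natl.
  rewrite (_ : #|_| = #|[set j | 0 < p j 0]%SET|); last first.
    by apply: eq_card => i; rewrite !inE.
  rewrite mulfV// pnatr_eq0 -lt0n card_gt0; apply/set0Pn.
  apply: contrapT => h; have := pp.2; rewrite big1 => [/eqP|i _].
    by rewrite eq_sym oner_eq0.
  apply/eqP; rewrite eq_le pp.1 andbT leNgt; apply/negP => pi.
  by apply: h; exists i; rewrite inE.
move=> i j; apply/eqP => Qij.
have [k kj] := stochastic_other_gt0 P i j sP (Pn1 i j); rewrite -Q_gt0 => Qik.
have := sQ.2 i; rewrite (bigD1 j)//= Qij (bigD1 k)//= => /eqP.
rewrite gt_eqF// ltrDl ltr_pwDl//.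
by apply: sumr_ge0 => a _; exact: Q_ge0.
Qed.

Let path_weightE i s : path (fun i j => 0 < Q i j) i s ->
  path_weight Q i s = lam ^- size s * (v (last i s) 0 / v i 0).
Proof.
elim: s i => [|j s IH] i /=; first by rewrite expr0 invr1 mul1r divff// gt_eqF.
move=> /andP[Qij ps]; rewrite IH// QE P0E -Q_gt0 Qij mulr1 exprS.
by field; rewrite !gt_eqF// exprn_gt0.
Qed.

Let vmin := \big[Num.min/1]_i v i 0.
Let vmin0 : 0 < vmin.
Proof. exact: lt_bigmin. Qed.
Let vmin_le i : vmin <= v i 0.
Proof. exact: bigmin_le. Qed.
Let v_le1 i : v i 0 <= 1.
Proof.
rewrite -Pv.1.2 (bigD1 i)//= lerDl sumr_ge0// => k _; exact: ltW.
Qed.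

(** A positive word of length [n.+1] weighs [q i 0 * lam ^- n] times a ratio of two coordinates of
    [v]. The factor [lam] accounts for there being one transition fewer than letters, [l%:R] for the
    initial weight, at least [l%:R^-1], and [vmin] for the ratio. *)
Let C := lam * l%:R / vmin.

Let C1 : 1 <= C.
Proof.
have l1 : 1 <= l%:R :> R by rewrite ler1n.
rewrite /C ler_pdivlMr// mul1r (le_trans _ (mulr_ege1 (ltW lam1) l1))//.
exact: le_trans (vmin_le (Ordinal l0)) (v_le1 _).
Qed.

Let word_weight_le n (w : n.-tuple 'I_l) : word_weight q Q w <= C * lam ^- n.
Proof.
have C0 : 0 < C by exact: lt_le_trans C1.
case: n w => [|n] w; first by rewrite (tuple0 w)/= expr0 invr1 mulr1.
case/tupleP : w => i s /=.
have [ps|nps] := boolP (path (fun i j => 0 < Q i j) i s); last first.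
  rewrite (_ : path_weight _ _ _ = 0) ?mulr0.
    by rewrite mulr_ge0 ?invr_ge0 ?exprn_ge0// ltW.
  by apply/eqP; rewrite eq_le path_weight_ge0// andbT leNgt path_weight_gt0.
rewrite path_weightE// size_tuple.
have q1 : q i 0 <= 1.
  have [[_ <-] _ _] := perron_markov_chain.
  by rewrite (bigD1 i)//= lerDl sumr_ge0.
have -> : C * lam ^- n.+1 = lam ^- n * (l%:R / vmin).
  by rewrite /C exprS; field; rewrite !gt_eqF// exprn_gt0.
apply: (@le_trans _ _ (lam ^- n * (v (last i s) 0 / v i 0))).
  by rewrite ler_piMl// mulr_ge0 ?divr_ge0 ?invr_ge0 ?exprn_ge0 ?(ltW lam0) ?(ltW (v0 _)).
rewrite ler_pM2l ?invr_gt0 ?exprn_gt0// ler_pM ?invr_ge0 ?(ltW (v0 _))//.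
  by rewrite (le_trans (v_le1 _))// ler1n.
by rewrite lef_pV2 ?posrE.
Qed.

Let word_weight_ge n (w : n.-tuple 'I_l) : 0 < word_weight q Q w ->
  C^-1 * lam ^- n <= word_weight q Q w.
Proof.
have C0 : 0 < C by exact: lt_le_trans C1.
case: n w => [|n] w; first by rewrite (tuple0 w)/= expr0 invr1 mulr1 invf_le1.
case/tupleP : w => i s; rewrite word_weight_gt0// => /andP[qi ps].
rewrite /= path_weightE// size_tuple.
have -> : C^-1 * lam ^- n.+1 = l%:R^-1 * (lam ^- n * (vmin / lam ^+ 2)).
  by rewrite /C exprS; field; rewrite !gt_eqF ?exprn_gt0 ?ltr0n.
have lamV k : 0 < lam ^- k by rewrite invr_gt0 exprn_gt0.
apply: ler_pM; first by rewrite invr_ge0.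
- by apply/ltW; rewrite !mulr_gt0.
- rewrite q_gt0 in qi; rewrite mxE qi.
  rewrite lef_pV2 ?posrE ?ltr0n// ?ler_nat; first by rewrite -[leqRHS]card_ord max_card.
  by rewrite card_gt0; apply/set0Pn; exists i; rewrite inE.
rewrite ler_pM2l//; apply: (@le_trans _ _ vmin).
  rewrite ler_pdivrMr ?exprn_gt0// ler_peMr ?(ltW vmin0)//.
  by rewrite exprn_ege1// ltW.
apply: (le_trans (vmin_le (last i s))).
by rewrite ler_pdivlMr// ler_piMr// ltW.
Qed.

Lemma perron_driven_exists :
  exists mbar : probability (measurableTypeR R) R, driven_by q Q mbar.
Proof.
have [pq sQ _] := perron_markov_chain.
have [||||mu [mu01 muw]] := measure_of_weights (word_weight q Q) l0.
- by move=> s; exact: word_weight_ge0.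
- by [].
- by move=> s; exact: word_weight_rcons.
- move=> e e0.
  have [n _ /(_ n (leqnn n)) /= ne] := near_geometric_lt R lam C e lam1 e0.
  by exists n => w; apply: (le_trans (word_weight_le n w)); exact: ltW.
- by exists mu; split => // n w _.
Qed.

Variable mbar : probability (measurableTypeR R) R.
Hypothesis mbarP : driven_by q Q mbar.

Lemma perron_adic_regular : adic_regular R l lam C mbar.
Proof.
have wE n (w : n.-tuple 'I_l) : mbar (adic_itv R w) = (word_weight q Q w)%:E.
  case: n w => [|n] w; last by apply mbarP.2.
  by rewrite (tuple0 w)/= /adic_itv word_pointE mul0r add0r expr0 invr1 mbarP.1.
split => //; first exact: mbarP.1.
- by move=> n w; rewrite wE lee_fin word_weight_le.
- by move=> n w; rewrite wE lte_fin lee_fin; exact: word_weight_ge.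
Qed.

Lemma perron_adic_gt0 (m : probability (measurableTypeR R) R) :
  driven_by p P m -> forall n (w : n.-tuple 'I_l),
  (0 < mbar (adic_itv R w))%E = (0 < m (adic_itv R w))%E.
Proof.
move=> mP n w; rewrite (driven_by_adic_gt0 q Q)//; last exact: perron_markov_chain.
rewrite (driven_by_adic_gt0 p P)//; case: (tval w) => // i s.
by rewrite q_gt0; congr (_ && _); apply: eq_path => a b; rewrite Q_gt0.
Qed.

End perron_chain.

Theorem corollary4p2 (R : realType) (l : nat) (hl : (2 <= l)%N)
    (p : 'cV[R]_l) (P : 'M[R]_l)
    (hpP : markov_chain p P) (hP : irreducible_mx P)
    (m : probability (measurableTypeR R) R) (hm : driven_by p P m) :
  let K := msupp m in
  let P0 := zero_one_mx P in
  (exists! pi0 : 'cV[R]_l, perron_vector P0 pi0) /\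
  forall pi0 : 'cV[R]_l, perron_vector P0 pi0 ->
    let Q0 := perron_stochastic_mx P0 pi0 in
    let p0 := unif_support p in
    [/\ forall i, 0 < pi0 i 0,
        markov_chain p0 Q0,
        exists mbar : probability (measurableTypeR R) R, driven_by p0 Q0 mbar
      & forall mbar : probability (measurableTypeR R) R,
          driven_by p0 Q0 mbar ->
          [/\ msupp mbar = K,
              monofractal l mbar,
              strongly_equivalent mbar
                (fun A => hausdorff_measure (fine (structure_fun l m 0))
                            (A `&` K))
            & exists d : \bar R,
                [/\ has_dim mbar d,
                    hausdorff_dim K = d,
                    has_box_dim K d
                  & forall m' : probability (measurableTypeR R) R,
                      markov_driven l m' -> msupp m' = K ->
                      (upper_dim m' <= d)%E]]].
Proof.
move=> K P0; split; first exact: (zero_one_perron_vector_unique p P hl hpP hP).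
move=> pi0 Pv Q0 p0; split.
- exact: (zero_one_perron_vector_gt0 p P hpP hP pi0 Pv).
- exact: (perron_markov_chain p P hl hpP hP pi0 Pv).
- exact: (perron_driven_exists p P hl hpP hP pi0 Pv).
move=> mbar hmbar.
have reg := perron_adic_regular p P hl hpP hP pi0 Pv mbar hmbar.
have gt0E := perron_adic_gt0 p P hl hpP hP pi0 Pv mbar hmbar m hm.
have KE : msupp mbar = K.
  apply/seteqP; split=> x.
    move=> /(msupp_adic mbar hl hmbar.1) h; apply/(msupp_adic m hl hm.1) => n.
    by have [w wp wx] := h n; exists w; rewrite -?gt0E.
  move=> /(msupp_adic m hl hm.1) h; apply/(msupp_adic mbar hl hmbar.1) => n.
  by have [w wp wx] := h n; exists w; rewrite ?gt0E.
have sE := adic_structure_fun _ _ mbar hl reg m.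
split.
- exact: KE.
- exact: adic_monofractal hl reg.
- rewrite sE => [|n w]; last first.
    by have := gt0E n w; rewrite !lt0e !measure_ge0 !andbT => /negb_inj.
  by rewrite -KE; exact: adic_strongly_equivalent hl reg.
exists (ln (spectral_radius P0) / ln l%:R)%:E; rewrite -KE; split.
- exact: adic_has_dim hl reg.
- exact: adic_hausdorff_dim hl reg.
- exact: adic_has_box_dim hl reg.
move=> m' [p' [P' [_ [m'01 _]]]] m'K.
rewrite -(adic_hausdorff_dim _ _ _ hl reg) -m'K.
apply: ereal_inf_lbound; exists (msupp m') => //.
by split; [exact: measurable_msupp|exact: msupp_measure1 hl m'01].
Qed.
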